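(* Let $\Phi$ be a $c_0$-symbol with $c_0\ge1$ and let $l\ge1$ be an integer. Assume that $\Phi(s)=c_0s+\sum_{n=1}^{+\infty}c_nn^{-s}$ where $c_n=0$ when $p^+(n)>l$. Then $$\|C_\Phi\|_{\mathcal{A}^2_\mu,e}\ge\limsup_{\Re(s)\to0}\frac{\|K^l_{\mu,\Phi(s)}\|_{\mathcal{A}^2_\mu}}{\|K^l_{\mu,s}\|_{\mathcal{A}^2_\mu}}.$$
   Context: For $\theta\in\mathbb{R}$, $\mathbb{C}_\theta=\{s\in\mathbb{C}:\Re(s)>\theta\}$ and $\mathbb{C}_+=\mathbb{C}_0$. $\mathcal{D}$ is the class of functions representable by a convergent Dirichlet series in some half-plane. $\mu$ is a probability measure on $(0,+\infty)$ with $0\in\mathrm{Supp}(\mu)$ and $d\mu(\sigma)=h(\sigma)\,d\sigma$, $h\ge0$, $\|h\|_{L^1((0,+\infty))}=1$. $\mathcal{A}^2_\mu$ is the Hilbert space of Dirichlet series $f=\sum_{n\ge1}a_nn^{-s}$ with $\|f\|^2_{\mathcal{A}^2_\mu}=\sum_{n\ge1}|a_n|^2w_h(n)<\infty$, where $w_h(n)=\int_0^{+\infty}n^{-2\sigma}h(\sigma)\,d\sigma$ (analytic functions on $\mathbb{C}_{1/2}$). For an integer $c_0\ge1$, a $c_0$-symbol is an analytic function $\Phi:\mathbb{C}_{1/2}\to\mathbb{C}_{1/2}$, $\Phi(s)=c_0s+\varphi(s)$ with $\varphi\in\mathcal{D}$, such that $C_\Phi:f\mapsto f\circ\Phi$ is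 bounded on $\mathcal{A}^2_\mu$; for $c_0\ge1$ this is taken, following the paper, to mean that the Dirichlet series of $\varphi$ converges uniformly on $\mathbb{C}_\varepsilon$ for every $\varepsilon>0$ and $\varphi(\mathbb{C}_+)\subset\mathbb{C}_+$. Then $\Phi$ is regarded as an analytic function on $\mathbb{C}_+$. $p^+(n)$ is the greatest prime divisor of $n$ (with $p^+(1)=1$) and $p_l$ the $l$-th prime. For $s\in\mathbb{C}_+$ the partial reproducing kernel of order $l$ at $s$ is $K^l_{\mu,s}(w)=\sum_{n\ge1,\,p^+(n)\le p_l}\frac{n^{-\overline{s}-w}}{w_h(n)}$, $w\in\mathbb{C}_+$; it belongs to $\mathcal{A}^2_\mu$. For a bounded operator $T$ on a Hilbert space $H$, $\|T\|_{H,e}=\inf\{\|T-K\|:K\text{ compact on }H\}$. $\limsup_{\Re(s)\to0}F(s)$ means $\lim_{\theta\to0^+}\sup_{0<\Re(s)<\theta}F(s)$. *)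

(* Defs.v *)
From HB Require Import structures.
From mathcomp Require Import all_boot all_order all_algebra.
From mathcomp Require Import all_classical all_reals all_analysis.
From mathcomp Require Import measurable_realfun.
From mathcomp Require Import complex ring lra.

Set Implicit Arguments.
Unset Strict Implicit.
Unset Printing Implicit Defensive.

Import Order.TTheory GRing.Theory Num.Theory.
Import numFieldNormedType.Exports.
Import Normc.

Local Open Scope classical_set_scope.
Local Open Scope complex_scope.
Local Open Scope ring_scope.

(* The library does not register the complex numbers [R[i]] as a normed
   module over themselves. *)
HB.instance Definition _ (R : realType) := NormedModule.copy R[i] R[i]^o.

Section dirichlet_series.
Context {R : realType}.
Implicit Types (c : nat -> R[i]) (s z : R[i]).

Definition half_plane (theta : R) : set R[i] := [set s | theta < complex.Re s].

(* [natpow n z] is n^z = exp (z log n), for n >= 1. *)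
Definition natpow (n : nat) z : R[i] :=
  let r := expR (complex.Re z * ln n%:R) in
  let t := complex.Im z * ln n%:R in
  (r * cos t) +i* (r * sin t).

(* Dirichlet series run over n >= 1, so [c 0] plays no role. *)
Definition dirichlet_sum c (N : nat) s : R[i] :=
  \sum_(1 <= n < N) c n * natpow n (- s).

Definition dirichlet_series c s : R[i] := limn (dirichlet_sum c ^~ s).

End dirichlet_series.

Definition msupport (R : realType) (mu : set R -> \bar R) : set R :=
  [set x | forall U, open_nbhs x U -> (0 < mu U)%E].

(* A probability measure on (0, +oo), seen as a probability on R carried by
   (0, +oo), with density and with 0 in its support. *)
Record weight_measure (R : realType) := WeightMeasure {
  wm_mu : probability (measurableTypeR R) R;
  wm_h : R -> R;
  wm_h_measurable : measurable_fun (`]0, +oo[ : set R) wm_h;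
  wm_h_ge0 : forall x, 0 < x -> 0 <= wm_h x;
  wm_h_L1 : (\int[lebesgue_measure]_(x in `]0%R, +oo[) `|wm_h x|%:E = 1)%E;
  wm_density : forall A : set R, measurable A ->
    wm_mu A = (\int[lebesgue_measure]_(x in A `&` `]0%R, +oo[) (wm_h x)%:E)%E;
  wm_supp0 : msupport wm_mu 0 }.

Section weight.
Context {R : realType} (mu : weight_measure R).

(* w_h(n) = \int_0^oo n^(-2 sigma) h(sigma) d sigma *)
Definition weight (n : nat) : R :=
  \int[lebesgue_measure]_(x in `]0, +oo[) (n%:R `^ (- (2 * x)) * wm_h mu x).

Lemma weight_ge0 n : 0 <= weight n.
Proof.
apply: fine_ge0; apply: integral_ge0 => x /=.
rewrite in_itv/= andbT => x0.
by rewrite lee_fin mulr_ge0 ?powR_ge0// wm_h_ge0.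
Qed.

Lemma weight_gt0 n : (0 < n)%N -> 0 < weight n.
Proof.
move=> n0.
set D := `]0, +oo[%classic : set R.
set f := fun x : R => n%:R `^ (- (2 * x)) * wm_h mu x.
have mD : measurable D by exact: measurable_itv.
have n0' : (0 : R) < n%:R by rewrite ltr0n.
have mh : measurable_fun D (fun x : R => (wm_h mu x)%:E).
  by apply/measurable_EFinP; exact: wm_h_measurable.
have mp : measurable_fun D (fun x : R => n%:R `^ (- (2 * x))).
  rewrite (_ : (fun x => _) = (fun x : R => expR (- (2 * x) * ln n%:R))).
    apply: measurableT_comp => //; apply: measurable_funM => //.
    apply: measurableT_comp => //; exact: measurable_funM.
  by apply/funext => x; rewrite /powR gt_eqF.
have mf : measurable_fun D (fun x : R => (f x)%:E).
  apply/measurable_EFinP; apply: measurable_funM => //.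
  exact: wm_h_measurable.
have f0 x : D x -> 0 <= f x.
  rewrite /D/= in_itv/= andbT => x0.
  by rewrite mulr_ge0 ?powR_ge0// wm_h_ge0.
have h0 x : D x -> 0 <= wm_h mu x.
  by rewrite /D/= in_itv/= andbT => x0; rewrite wm_h_ge0.
rewrite /weight -/D -/f; apply: fine_gt0; apply/andP; split; last first.
  apply: (@le_lt_trans _ _ (\int[lebesgue_measure]_(x in D)
    `|wm_h mu x|%:E)%E); last by rewrite wm_h_L1 ltry.
  apply: ge0_le_integral => //.
  - by apply/measurable_EFinP; apply: measurableT_comp => //;
      apply/measurable_EFinP.
  - move=> x Dx; rewrite lee_fin /f ger0_norm ?h0//.
    rewrite ler_piMl ?h0//.
    move: Dx; rewrite /D/= in_itv/= andbT => x0.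
    rewrite /powR gt_eqF// -[leRHS]expR0 ler_expR mulNr oppr_le0.
    by apply: mulr_ge0; [exact: mulr_ge0 (ltW x0) | apply: ln_ge0; rewrite ler1n].
rewrite lt0e; apply/andP; split; last first.
  by apply: integral_ge0 => x Dx; rewrite lee_fin f0.
apply/eqP => If0.
have : (\int[lebesgue_measure]_(x in D) `|(f x)%:E| = 0)%E.
  rewrite -[RHS]If0; apply: eq_integral => x /[!inE] Dx.
  by rewrite /= ger0_norm// f0.
move/(ae_eq_integral_abs lebesgue_measure mD mf) => fae.
have hae : ae_eq lebesgue_measure D (fun x : R => (wm_h mu x)%:E) (cst 0%E).
  apply: filterS fae => x + Dx => /(_ Dx) /= [] /eqP.
  rewrite mulf_eq0 => /orP[|/eqP -> //].
  by rewrite gt_eqF// powR_gt0.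
move/(ae_eq_integral_abs lebesgue_measure mD mh) : hae.
have -> : (\int[lebesgue_measure]_(x in D) `|(wm_h mu x)%:E| = 1)%E.
  by rewrite -(wm_h_L1 mu).
by move/eqP; rewrite onee_eq0.
Qed.

End weight.

Lemma normc_ge0 (R : realType) (z : R[i]) : 0 <= normc z.
Proof. by case: z => x y; exact: sqrtr_ge0. Qed.

Section bergman_space.
Context {R : realType} (mu : weight_measure R).
Implicit Types a b : nat -> R[i].

Definition A2_sqnorm a : \bar R :=
  (\sum_(1 <= n <oo) (normc (a n) ^+ 2 * weight mu n)%:E)%E.

(* The function sum_(n >= 1) a_n n^(-s) is represented by its coefficients;
   the unused [a 0] is normalised to 0. *)
Definition A2_pred : {pred (nat -> R[i])} :=
  fun a => `[< a 0%N = 0 /\ (A2_sqnorm a < +oo)%E >].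

Lemma A2_term_ge0 a n : (0 <= (normc (a n) ^+ 2 * weight mu n)%:E)%E.
Proof. by rewrite lee_fin mulr_ge0 ?exprn_ge0 ?normc_ge0 ?weight_ge0. Qed.

Lemma A2_sqnorm_ge0 a : (0 <= A2_sqnorm a)%E.
Proof. by apply: nneseries_ge0 => n _ _; exact: A2_term_ge0. Qed.

Lemma A2_sqnormZ l a : A2_sqnorm (l *: a) = ((normc l ^+ 2)%:E * A2_sqnorm a)%E.
Proof.
rewrite /A2_sqnorm -nneseriesZl; last by move=> n _; exact: A2_term_ge0.
by apply: eq_eseriesr => n _; rewrite -EFinM mulrA -exprMn -normcM.
Qed.

Lemma A2_sqnormD_wgt (u v : R) a b : 0 <= u -> 0 <= v -> u * v = 1 ->
  (A2_sqnorm (a + b)%R <=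
   (1 + u)%:E * A2_sqnorm a + (1 + v)%:E * A2_sqnorm b)%E.
Proof.
move=> u0 v0 uv.
rewrite /A2_sqnorm -!nneseriesZl; try by move=> n _; exact: A2_term_ge0.
rewrite -nneseriesD; last 2 first.
- by move=> n _ _; rewrite mule_ge0 ?A2_term_ge0// lee_fin addr_ge0.
- by move=> n _ _; rewrite mule_ge0 ?A2_term_ge0// lee_fin addr_ge0.
apply: lee_nneseries => n _; first by move=> _; exact: A2_term_ge0.
rewrite -!EFinM -EFinD lee_fin !mulrA -mulrDl.
apply: ler_wpM2r; first exact: weight_ge0.
have le1 : normc (a n + b n) <= normc (a n) + normc (b n).
  by rewrite -lecR rmorphD/=; exact: (ler_normD (a n) (b n)).
apply: (@le_trans _ _ ((normc (a n) + normc (b n)) ^+ 2)).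
  by rewrite ler_pXn2r ?nnegrE ?addr_ge0 ?normc_ge0.
move: (normc (a n)) (normc (b n)) => x y.
suff : 2 * (x * y) <= u * x ^+ 2 + v * y ^+ 2.
  by move=> h; rewrite sqrrD !mulrDl !mul1r -mulr_natl; lra.
have [su sv] : Num.sqrt u ^+ 2 = u /\ Num.sqrt v ^+ 2 = v.
  by rewrite !sqr_sqrtr.
have suv : Num.sqrt u * Num.sqrt v = 1 by rewrite -sqrtrM// uv sqrtr1.
have := sqr_ge0 (Num.sqrt u * x - Num.sqrt v * y).
rewrite sqrrB !exprMn su sv mulrACA suv mul1r -mulr_natl; lra.
Qed.

Lemma A2_submod_closed : submod_closed A2_pred.
Proof.
split.
  apply/asboolP; split=> //; rewrite /A2_sqnorm eseries0 ?ltry// => n _ _.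
  by rewrite normc0 expr0n mul0r.
move=> l a b /asboolP[a0 Ha] /asboolP[b0 Hb]; apply/asboolP; split.
  have -> : (l *: a + b) 0%N = l * a 0%N + b 0%N by [].
  by rewrite a0 b0 mulr0 addr0.
apply: (le_lt_trans (@A2_sqnormD_wgt 1 1 _ _ _ _ _)) => //; first by rewrite mulr1.
rewrite lte_add_pinfty ?lte_mul_pinfty ?lee_fin// A2_sqnormZ.
by rewrite lte_mul_pinfty ?lee_fin ?exprn_ge0 ?normc_ge0.
Qed.

HB.instance Definition _ := GRing.isSubmodClosed.Build _ _ A2_pred
  A2_submod_closed.

Record A2 := MkA2 { A2_coef :> nat -> R[i]; _ : A2_coef \in A2_pred }.

HB.instance Definition _ := [isSub for A2_coef].
HB.instance Definition _ := [Choice of A2 by <:].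
HB.instance Definition _ := [SubChoice_isSubLmodule of A2 by <:].

(* The norm of a normed module over [R[i]] takes values in [R[i]]. *)
Definition A2_norm (f : A2) : R[i] := (Num.sqrt (fine (A2_sqnorm f)))%:C.

Lemma A2_sqnorm_fin (f : A2) : A2_sqnorm f \is a fin_num.
Proof.
have /asboolP[_ fin_f] := valP f.
by rewrite ge0_fin_numE ?A2_sqnorm_ge0.
Qed.

Lemma A2_sqnorm_fine (f : A2) :
  A2_sqnorm f = (Num.sqrt (fine (A2_sqnorm f)) ^+ 2)%:E.
Proof. by rewrite sqr_sqrtr ?fine_ge0 ?A2_sqnorm_ge0// fineK ?A2_sqnorm_fin. Qed.

Lemma A2_norm0_eq0 f : A2_norm f = 0 -> f = 0.
Proof.
move=> /complexI f0; have /asboolP[f00 _] := valP f.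
have S0 : A2_sqnorm f = 0%:E by rewrite A2_sqnorm_fine f0 expr0n.
apply/val_inj/funext => -[|n]; first exact: f00.
apply: eq0_normc; apply/eqP; rewrite -sqrf_eq0 eq_le sqr_ge0 andbT.
rewrite -(ler_pM2r (weight_gt0 mu (ltn0Sn n))) mul0r -lee_fin -S0.
apply: le_trans; last first.
  by apply: (@nneseries_lim_ge _ _ xpredT _ n.+2) => k _ _; exact: A2_term_ge0.
by rewrite big_nat_recr//= leeDr// sume_ge0// => k _; exact: A2_term_ge0.
Qed.

Lemma A2_normZ l f : A2_norm (l *: f) = `|l| * A2_norm f.
Proof.
rewrite -[`|l|]/((normc l)%:C) -rmorphM/=; congr (_ %:C).
rewrite /= A2_sqnormZ fineM ?A2_sqnorm_fin//= sqrtrM ?exprn_ge0 ?normc_ge0// sqrtr_sqr.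
by rewrite ger0_norm ?normc_ge0.
Qed.

Lemma A2_normD f g : A2_norm (f + g) <= A2_norm f + A2_norm g.
Proof.
rewrite -rmorphD/= lecR.
set A := Num.sqrt (fine (A2_sqnorm f)).
set B := Num.sqrt (fine (A2_sqnorm g)).
have [A0|A0] := eqVneq A 0.
  have -> : f = 0 by apply: A2_norm0_eq0; rewrite /A2_norm -/A A0.
  by rewrite add0r A0 add0r.
have [B0|B0] := eqVneq B 0.
  have -> : g = 0 by apply: A2_norm0_eq0; rewrite /A2_norm -/B B0.
  by rewrite addr0 B0 addr0.
have Agt : 0 < A by rewrite lt_def A0 sqrtr_ge0.
have Bgt : 0 < B by rewrite lt_def B0 sqrtr_ge0.
rewrite -(ler_pXn2r (ltn0Sn 1)) ?nnegrE ?sqrtr_ge0 ?addr_ge0 ?sqrtr_ge0//.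
rewrite -lee_fin -A2_sqnorm_fine.
have := @A2_sqnormD_wgt (B / A) (A / B) f g.
rewrite (A2_sqnorm_fine f) (A2_sqnorm_fine g) -/A -/B => h.
apply: le_trans (h _ _ _) _.
- by rewrite divr_ge0// ltW.
- by rewrite divr_ge0// ltW.
- by rewrite mulrA divfK// divff.
rewrite -!EFinM -EFinD lee_fin le_eqVlt; apply/orP; left; apply/eqP.
by field; rewrite A0 B0.
Qed.

HB.instance Definition _ :=
  Lmodule_isNormed.Build R[i] A2 A2_normD A2_normZ A2_norm0_eq0.

(* Norm in A2 of a function on C_(1/2), equal to +oo when the function is not
   in the space. *)
Definition A2_fun_norm (F : R[i] -> R[i]) : \bar R :=
  ereal_inf [set (complex.Re `|f|)%:E | f in [set f : A2 |
    forall s, half_plane 2^-1 s -> F s = dirichlet_series f s]].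

Definition compact_operator (K : {linear A2 -> A2}) : Prop :=
  compact (closure (K @` [set f : A2 | `|f| <= 1])).

(* An operator T is given by the functions s |-> T f s on C_(1/2). A linear T
   is a bounded operator from A2 to A2 exactly when [A2_op_norm T] is finite,
   and [A2_op_norm T] is then its operator norm. *)
Definition A2_op_norm (T : A2 -> R[i] -> R[i]) : \bar R :=
  ereal_sup [set A2_fun_norm (T f) | f in [set f : A2 | `|f| <= 1]].

Definition A2_ess_norm (T : A2 -> R[i] -> R[i]) : \bar R :=
  ereal_inf [set A2_op_norm (fun f s => T f s - dirichlet_series (K f) s) |
    K in compact_operator].

Definition composition_op (Phi : R[i] -> R[i]) (f : A2) (s : R[i]) : R[i] :=
  dirichlet_series f (Phi s).

End bergman_space.
Arguments A2_ess_norm {R} mu T.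
Arguments composition_op {R} mu Phi f s.

(* [Phi] is a c_0-symbol with c_0 >= 1, viewed as a function on C_0, and
   sum_(n >= 1) c_n n^(-s) is the Dirichlet series of phi = Phi - c_0 s. *)
Record is_symbol (R : realType) (c0 : nat) (c : nat -> R[i])
    (Phi : R[i] -> R[i]) : Prop := IsSymbol {
  symbol_c0 : (1 <= c0)%N;
  symbol_analytic : forall s, half_plane 0 s -> derivable Phi s 1;
  symbol_half : forall s, half_plane 2^-1 s -> half_plane 2^-1 (Phi s);
  symbol_uniform : forall eps : R, 0 < eps ->
    {uniform half_plane eps,
      dirichlet_sum c @ \oo --> (fun s => Phi s - c0%:R * s)};
  symbol_pos : forall s, half_plane 0 s -> half_plane 0 (Phi s - c0%:R * s) }.

Lemma exists_prime_gt (m : nat) : exists p, (m < p)%N && prime p.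
Proof. by have [p mp pp] := prime_above m; exists p; rewrite mp. Qed.

(* [nth_prime l] is the l-th prime: [nth_prime 1 = 2], [nth_prime 2 = 3]. *)
Definition nth_prime (l : nat) : nat :=
  iter l (fun m => ex_minn (exists_prime_gt m)) 0.

(* [max_pdiv] is the greatest prime divisor, with [max_pdiv 1 = 1]. *)
Definition partial_kernel (R : realType) (mu : weight_measure R) (l : nat)
    (s w : R[i]) : R[i] :=
  limn (fun N => \sum_(1 <= n < N | (max_pdiv n <= nth_prime l)%N)
    natpow n (- s^*%C - w) / (weight mu n)%:C).

Definition limsup_Re0 (R : realType) (F : R[i] -> \bar R) : \bar R :=
  lim (ereal_sup [set F s | s in [set s : R[i] | 0 < complex.Re s < theta]]
    @[theta --> 0^'+]).

(* Main.v *)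
From HB Require Import structures.
From mathcomp Require Import all_boot all_order all_algebra.
From mathcomp Require Import all_classical all_reals all_analysis.
From mathcomp Require Import measurable_realfun.
From mathcomp Require Import complex ring lra.
Require Import Defs.

Set Implicit Arguments.
Unset Strict Implicit.
Unset Printing Implicit Defensive.

Import Order.TTheory GRing.Theory Num.Theory.
Import numFieldNormedType.Exports.
Import Normc.

Local Open Scope classical_set_scope.
Local Open Scope complex_scope.
Local Open Scope ring_scope.

(** Write [C] for the composition operator, [P] for the [l]-th prime, and
    [k(x)] for the norm of the partial kernel at a point of real part [x], so
    that [k(x)^2] is the sum of [n^(-2x) / w(n)] over the [P]-smooth integers.

    By Cauchy-Schwarz, evaluating at [s] the [P]-smooth part of an element
    [f] of the space costs at most [||f|| k(Re s)], although [f] itself need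
    not converge at [s] ([smooth_part_eval_le]).  As the series of [Phi - c0 s]
    runs over [P]-smooth integers, so does that of [f o Phi] for every
    [P]-smooth Dirichlet polynomial [f], and the latter converges absolutely
    on the whole right half-plane ([smooth_series_natpow_symbol]).  For a compact
    [K] and [g = C f - K f], the equality [f o Phi = K f + g], known only on
    [Re > 1/2], therefore propagates to
    [f(Phi(s)) = (K f)_P(s) + g_P(s)] on [Re > 0]: the coefficients of
    [K f + g] are those of the smooth series of [f o Phi], by uniqueness of
    Dirichlet coefficients ([dirichlet_unique]).  For [f] a truncation of the
    kernel at [Phi(s)], divided by its norm, the left-hand side is arbitrarily
    close to [k(Re Phi(s))], whence, up to a vanishing error,
    [k(Re Phi(s)) <= |(K f)_P(s)| + ||C - K|| k(Re s)]
    ([kernel_norm_symbol_le]).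

    It remains to see that [|(K f)_P(s)| / k(Re s)] tends to [0] as [Re s]
    does, uniformly for [f] in the unit ball.  For a fixed element in place of
    [K f] this holds because [k] blows up at [0] ([kernel_norm_cvg_pinfty])
    while a Dirichlet polynomial stays bounded; compactness of [K] gives the
    uniformity ([compact_smooth_part_eval_small]).

    No analytic continuation enters: every function involved is an absolutely
    convergent Dirichlet series.  Over the integers whose prime factors are
    bounded, pointwise convergence on the right half-plane already implies
    absolute convergence ([smooth_series_of_cvg]), because the smooth integers
    are so sparse that [n^(-x)] is summable over them for every [x > 0].
    Such series are stable under products and exponentials, both obtained by
    dominated convergence for series ([tannery]). *)

(** * Sequences and series of complex numbers *)

Section sequence_limits.
Context {K : numFieldType}.
Implicit Types (u v : nat -> K) (z w : K).

Lemma seq_cvgD u v z w : u @ \oo --> z -> v @ \oo --> w ->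
  (fun n => u n + v n) @ \oo --> z + w.
Proof. by move=> uz vw; apply: cvgD. Qed.

Lemma seq_cvgB u v z w : u @ \oo --> z -> v @ \oo --> w ->
  (fun n => u n - v n) @ \oo --> z - w.
Proof. by move=> uz vw; apply: cvgB. Qed.

Lemma seq_cvgM u v z w : u @ \oo --> z -> v @ \oo --> w ->
  (fun n => u n * v n) @ \oo --> z * w.
Proof. by move=> uz vw; apply: cvgM. Qed.

Lemma seq_lim u z : u @ \oo --> z -> limn u = z.
Proof. by move/cvg_lim; apply; exact: norm_hausdorff. Qed.

Lemma seq_cvg_sum (t : nat -> nat -> K) (l : nat -> K) m A :
  (forall k, (m <= k)%N -> t ^~ k @ \oo --> l k) ->
  (fun N => \sum_(m <= k < A) t N k) @ \oo --> \sum_(m <= k < A) l k.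
Proof.
move=> tl; rewrite big_nat.
rewrite (_ : (fun N => _) = (fun N => \sum_(m <= k < A | (m <= k < A)%N) t N k)); last first.
  by apply/funext => N; rewrite [LHS]big_nat.
apply: cvg_big => [|k /andP[mk _]]; first exact: add_continuous.
exact: tl.
Qed.
End sequence_limits.

Section complex_limits.
Context {R : realType}.
Implicit Types (u v : nat -> R[i]) (z w : R[i]).

Lemma complex_cvg_ext u v z w : u =1 v -> u @ \oo --> z -> z = w -> v @ \oo --> w.
Proof. by move=> /funext -> + <-. Qed.

Lemma normcD z w : normc (z + w) <= normc z + normc w.
Proof. by rewrite -lecR rmorphD/=; exact: (ler_normD z w). Qed.

Lemma normcB z w : normc (z - w) = normc (w - z).
Proof. by rewrite -opprB normcN. Qed.

Lemma normc_real (x : R) : normc x%:C = `|x|.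
Proof. by rewrite /= expr0n addr0 sqrtr_sqr. Qed.

Lemma normc_sum (I : Type) (r : seq I) (P : pred I) (F : I -> R[i]) :
  normc (\sum_(i <- r | P i) F i) <= \sum_(i <- r | P i) normc (F i).
Proof.
elim/big_ind2 : _ => //; first by rewrite normc0.
by move=> a b c d ab cd; apply: le_trans (normcD _ _) (lerD _ _).
Qed.

Lemma normcX z k : normc (z ^+ k) = normc z ^+ k.
Proof. by elim: k => [|k IH]; rewrite ?expr0 ?normc1// !exprS normcM IH. Qed.

Lemma complex_cvgP u z : u @ \oo --> z <->
  forall e : R, 0 < e -> \forall n \near \oo, normc (u n - z) <= e.
Proof.
split=> [/cvgrPdist_le uz e e0|h].
  have eC : 0 < e%:C by rewrite ltcR.
  apply: filterS (uz _ eC) => n.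
  by rewrite -[`|_|]/((normc _)%:C) lecR normcB.
apply/cvgrPdist_le => e e0.
have -> : e = (complex.Re e)%:C by rewrite RRe_real// gtr0_real.
have /h : 0 < complex.Re e by move: e0; rewrite ltcE => /andP[].
by apply: filterS => n; rewrite -[`|_|]/((normc _)%:C) lecR normcB.
Qed.

Lemma normc_lim_le u z (B : R) : u @ \oo --> z ->
  (\forall n \near \oo, normc (u n) <= B) -> normc z <= B.
Proof.
move=> /complex_cvgP uz uB; apply/ler_addgt0Pl => e /uz ue.
near \oo => n.
rewrite -[z](subrK (u n)) (le_trans (normcD _ _))//.
by rewrite lerD//; [rewrite normcB; near: n | near: n].
Unshelve. all: by end_near. Qed.

(** Some partial sum comes within [e] of the supremum, which leaves at most [e]
    for the terms after it. *)
Lemma small_tail (M : nat -> R) m (B e : R) : (forall k, 0 <= M k) ->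
  (forall N, \sum_(m <= k < N) M k <= B) -> 0 < e ->
  exists2 A, (m <= A)%N & forall N, \sum_(A <= k < N) M k <= e.
Proof.
move=> M0 MB e0.
pose S := [set \sum_(m <= k < N) M k | N in [set: nat]].
have hS : has_sup S.
  split; first by exists (\sum_(m <= k < 0) M k), 0%N.
  by exists B => _ [N _ <-].
have [_ [N0 _ <-] N0S] := sup_adherent e0 hS.
exists (maxn m N0); first exact: leq_maxl.
move=> N; have [NA|AN] := leqP N (maxn m N0).
  by rewrite big_geq// ltW.
have : \sum_(m <= k < N) M k <= sup S by apply: ub_le_sup; [exact: hS.2 | exists N].
rewrite (@big_cat_nat _ _ _ (maxn m N0))//= ?leq_maxl ?(ltnW AN)//.
suff : \sum_(m <= k < N0) M k <= \sum_(m <= k < maxn m N0) M k by lra.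
have [mN|Nm] := leqP m N0; first by [].
by rewrite !big_geq// ltnW.
Qed.

(** Dominated convergence for series.  The truncation bound [N] and the
    parameter of the terms grow together: this is the shape in which products
    and exponentials of series arise. *)
Lemma tannery_sub (t : nat -> nat -> R[i]) (l : nat -> R[i]) (M : nat -> R) m B :
  (forall k, (m <= k)%N -> t ^~ k @ \oo --> l k) ->
  (forall N k, (m <= k)%N -> normc (t N k) <= M k) ->
  (forall k, 0 <= M k) ->
  (forall N, \sum_(m <= k < N) M k <= B) ->
  (fun N => \sum_(m <= k < N) t N k - \sum_(m <= k < N) l k) @ \oo --> (0 : R[i]).
Proof.
move=> tl tM M0 MB.
apply/complex_cvgP => e e0.
have lM k : (m <= k)%N -> normc (l k) <= M k.
  by move=> mk; apply: normc_lim_le (tl _ mk) _; near=> n; exact: tM.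
(* Beyond [A] both sums are bounded by the tail of [M]; a third of [e] is
   spent on the terms before [A] and on each of the two tails. *)
have [A mA tailA] := small_tail M0 MB (divr_gt0 e0 (ltr0n _ 3)).
have hd : (fun N => \sum_(m <= k < A) (t N k - l k)) @ \oo --> (0 : R[i]).
  rewrite [X in _ --> X](_ : _ = \sum_(m <= k < A) (l k - l k)); last first.
    by rewrite big1// => k _; rewrite subrr.
  by apply: seq_cvg_sum => k mk; apply: seq_cvgB; [exact: tl | exact: cvg_cst].
move/complex_cvgP : hd => /(_ _ (divr_gt0 e0 (ltr0n _ 3))) hd.
near=> N.
have AN : (A <= N)%N by near: N; exact: nbhs_infty_ge.
rewrite subr0 -sumrB (@big_cat_nat _ _ _ A)//=.
have h1 : normc (\sum_(m <= k < A) (t N k - l k)) <= e / 3.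
  by rewrite -[X in normc X]subr0; near: N.
have h2 : normc (\sum_(A <= k < N) (t N k - l k)) <= e / 3 + e / 3.
  apply: le_trans (normc_sum _ _ _) _.
  apply: (@le_trans _ _ (\sum_(A <= k < N) (M k + M k))).
    rewrite big_nat [leRHS]big_nat; apply: ler_sum => k /andP[Ak _].
    have mk := leq_trans mA Ak.
    by apply: le_trans (normcD _ _) _; rewrite normcN lerD ?tM ?lM.
  by rewrite big_split/= lerD ?tailA.
by apply: le_trans (normcD _ _) _; lra.
Unshelve. all: by end_near. Qed.

Lemma tannery (t : nat -> nat -> R[i]) (l : nat -> R[i]) (M : nat -> R) m B z :
  (forall k, (m <= k)%N -> t ^~ k @ \oo --> l k) ->
  (forall N k, (m <= k)%N -> normc (t N k) <= M k) ->
  (forall k, 0 <= M k) ->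
  (forall N, \sum_(m <= k < N) M k <= B) ->
  (fun N => \sum_(m <= k < N) l k) @ \oo --> z ->
  (fun N => \sum_(m <= k < N) t N k) @ \oo --> z.
Proof.
move=> tl tM M0 MB lz.
apply: complex_cvg_ext (seq_cvgD (tannery_sub tl tM M0 MB) lz) (add0r z) => N.
by rewrite subrK.
Qed.

Lemma complex_cvg_ReIm (x y : nat -> R) (a b : R) : x @ \oo --> a -> y @ \oo --> b ->
  (fun n => x n +i* y n) @ \oo --> a +i* b.
Proof.
move=> /cvgrPdist_le xa /cvgrPdist_le yb; apply/complex_cvgP => e e0.
have e2 : 0 < e / 2 by rewrite divr_gt0.
near=> n.
have -> : (x n +i* y n) - (a +i* b) = (x n - a)%:C + (y n - b)%:C * 'i%C.
  by apply/eqP; rewrite eq_complex/=; apply/andP; split; apply/eqP; ring.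
apply: le_trans (normcD _ _) _; rewrite normcM !normc_real.
rewrite [normc 'i%C](_ : _ = 1) ?mulr1; last by rewrite /= expr0n expr1n add0r sqrtr1.
rewrite [e]splitr lerD// distrC; near: n; [exact: xa|exact: yb].
Unshelve. all: by end_near. Qed.

Lemma sum_complex (f g : nat -> R) m N :
  \sum_(m <= k < N) (f k +i* g k) =
  (\sum_(m <= k < N) f k) +i* (\sum_(m <= k < N) g k).
Proof.
apply/esym; apply: (big_ind3 (fun a c d => a +i* c = d)) => //.
by move=> x1 x2 x3 y1 y2 y3 <- <-.
Qed.

Lemma abs_sum_cvg (b : nat -> R[i]) m B :
  (forall N, \sum_(m <= k < N) normc (b k) <= B) ->
  exists z, (fun N => \sum_(m <= k < N) b k) @ \oo --> z.
Proof.
move=> bB.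
have Re_le z : `|complex.Re z| <= normc z.
  by rewrite -lecR; exact: normc_ge_Re.
have Im_le z : `|complex.Im z| <= normc z.
  by have := Re_le (z * 'i%C); rewrite ReiNIm normrN normcM [normc 'i%C](_ : _ = 1) ?mulr1//= expr0n expr1n add0r sqrtr1.
have rcv (f : nat -> R) : (forall k, `|f k| <= normc (b k)) ->
    exists x : R, (fun N => \sum_(m <= k < N) f k) @ \oo --> x.
  move=> fb; pose g k := if (m <= k)%N then f k else 0.
  have -> : (fun N => \sum_(m <= k < N) f k) = series g.
    by apply/funext => N; rewrite (big_nat_widenl _ 0)//= big_mkcond.
  exists (limn (series g)); suff : cvgn [normed series g] by move/normed_cvg.
  apply: nondecreasing_is_cvgn; first by apply: (@nondecreasing_series _ (fun k => `|g k|) xpredT 0) => k _ _; exact: normr_ge0.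
  exists B => _ [N _ <-] /=; apply: le_trans (bB N).
  rewrite /series/= [leRHS](big_nat_widenl _ 0)//= [leRHS]big_mkcond.
  by apply: ler_sum => k _; rewrite /g; case: ifP; rewrite ?normr0.
have [x xc] := rcv (fun k => complex.Re (b k)) (fun=> Re_le _).
have [y yc] := rcv (fun k => complex.Im (b k)) (fun=> Im_le _).
exists (x +i* y); apply: complex_cvg_ext (complex_cvg_ReIm xc yc) erefl => N.
by rewrite -sum_complex; apply: eq_bigr => k _; case: (b k).
Qed.

End complex_limits.

(** * The power series of the complex exponential *)

Section cexp.
Context {R : realType}.
Implicit Types z w : R[i].

Definition cexp z : R[i] :=
  (expR (complex.Re z) * cos (complex.Im z)) +i*
  (expR (complex.Re z) * sin (complex.Im z)).

Lemma cexpD z w : cexp (z + w) = cexp z * cexp w.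
Proof.
case: z => a b; case: w => c d; rewrite /cexp/= expRD cosD sinD.
by apply/eqP; rewrite eq_complex/=; apply/andP; split; apply/eqP; ring.
Qed.

Lemma cexp0 : cexp 0 = 1.
Proof. by rewrite /cexp/= expR0 cos0 sin0 mulr1 mulr0. Qed.

Lemma normc_cexp z : normc (cexp z) = expR (complex.Re z).
Proof.
rewrite /cexp/= !exprMn -mulrDr cos2Dsin2 mulr1 sqrtr_sqr ger0_norm//.
Qed.

Lemma exp_sum_le (x : R) N : 0 <= x ->
  \sum_(0 <= k < N) x ^+ k / k`!%:R <= expR x.
Proof.
move=> x0; apply: (@nondecreasing_cvgn_le _ (series (exp_coeff x)) _).
  apply: (@nondecreasing_series _ (exp_coeff x) xpredT 0) => k _ _.
  exact: exp_coeff_ge0.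
exact: is_cvg_series_exp_coeff.
Qed.

Definition taylor_exp N z : R[i] := \sum_(0 <= k < N) z ^+ k / k`!%:R.

(** Both sides run over the pairs [(j, i)] with [j + i < N]. *)
Lemma triangular_sum (V : nmodType) (a : nat -> nat -> V) N :
  \sum_(0 <= k < N) \sum_(0 <= j < k.+1) a j (k - j)%N =
  \sum_(0 <= j < N) \sum_(0 <= i < N - j) a j i.
Proof.
elim: N => [|N IH]; first by rewrite !big_geq.
rewrite big_nat_recr//= IH [RHS]big_nat_recr//= subSnn [X in _ + X]big_nat_recr//= subnn.
rewrite [X in _ = _ + X]big_nat1 addrA; congr (_ + _).
rewrite -big_split/= !big_nat; apply: eq_bigr => j /andP[_ jN].
by rewrite subSn 1?ltnW// big_nat_recr.
Qed.

Lemma taylor_expD N z w : taylor_exp N (z + w) =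
  \sum_(0 <= j < N) z ^+ j / j`!%:R * taylor_exp (N - j) w.
Proof.
rewrite /taylor_exp.
under [RHS]eq_bigr do rewrite mulr_sumr.
rewrite -(triangular_sum (fun j i => z ^+ j / j`!%:R * (w ^+ i / i`!%:R))).
apply: eq_bigr => k _.
rewrite addrC exprDn mulr_suml big_mkord; apply: eq_bigr => j _.
have jk : (j <= k)%N by rewrite -ltnS.
have hk := bin_fact jk.
have f0 (n : nat) : (n`!%:R : R[i]) != 0 by rewrite pnatr_eq0 -lt0n fact_gt0.
rewrite -hk !natrM -mulr_natr.
have b0 : ('C(k, j)%:R : R[i]) != 0 by rewrite pnatr_eq0 -lt0n bin_gt0.
by field; rewrite !f0 b0.
Qed.

Lemma normc_fact k : normc (k`!%:R^-1 : R[i]) = k`!%:R^-1.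
Proof.
rewrite normcV [X in normc X](_ : _ = (k`!%:R)%:C); last by rewrite rmorph_nat.
by rewrite normc_real ger0_norm.
Qed.

Lemma normc_taylor z k : normc (z ^+ k / k`!%:R) = normc z ^+ k / k`!%:R.
Proof. by rewrite normcM normcX normc_fact. Qed.

Lemma taylor_exp_le N z : normc (taylor_exp N z) <= expR (normc z).
Proof.
apply: le_trans (normc_sum _ _ _) _.
under eq_bigr do rewrite normc_taylor.
exact: exp_sum_le (normc_ge0 _).
Qed.

Lemma subn_cvg (K : numFieldType) (u : nat -> K) (x : K) j : u @ \oo --> x ->
  (fun N => u (N - j)%N) @ \oo --> x.
Proof.
by move=> uz; rewrite -(cvg_shiftn j)/=; under eq_fun do rewrite addnK.
Qed.

(** Cauchy product: for fixed [j] the inner factor [taylor_exp (N - j) w] tends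
    to [b], and the terms are dominated by those of [exp |z| * exp |w|]. *)
Lemma taylor_exp_mul z w (a b : R[i]) : taylor_exp ^~ z @ \oo --> a ->
  taylor_exp ^~ w @ \oo --> b -> taylor_exp ^~ (z + w) @ \oo --> a * b.
Proof.
move=> za wb; rewrite (funext (fun N => taylor_expD N z w)).
apply: (@tannery _ _ (fun j => z ^+ j / j`!%:R * b)
  (fun j => normc z ^+ j / j`!%:R * expR (normc w)) _
  (expR (normc z) * expR (normc w))).
- by move=> j _; apply: seq_cvgM; [exact: cvg_cst | exact: (@subn_cvg _ (taylor_exp ^~ w))].
- by move=> N j _; rewrite normcM normc_taylor ler_wpM2l ?taylor_exp_le// divr_ge0// exprn_ge0 ?normc_ge0.
- by move=> j; rewrite mulr_ge0 ?expR_ge0// divr_ge0// exprn_ge0 ?normc_ge0.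
- move=> N; rewrite -mulr_suml ler_wpM2r ?expR_ge0//.
  exact: exp_sum_le (normc_ge0 _).
rewrite (_ : (fun N => _) = fun N => taylor_exp N z * b); last first.
  by apply/funext => N; rewrite mulr_suml.
by apply: seq_cvgM; [exact: za | exact: cvg_cst].
Qed.

Lemma imaginary_exp_coeff (y : R) k :
  (0 +i* y) ^+ k / k`!%:R = cos_coeff y k +i* sin_coeff y k.
Proof.
have h n : (0 +i* y) ^+ n.*2 = ((-1) ^+ n * y ^+ n.*2)%:C.
  elim: n => [|n IH]; first by rewrite !expr0 mulr1.
  rewrite doubleS !exprS IH.
  by apply/eqP; rewrite eq_complex/=; apply/andP; split; apply/eqP; ring.
have -> : (k`!%:R : R[i])^-1 = ((k`!%:R)^-1 : R)%:C by rewrite fmorphV rmorph_nat.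
rewrite -[k]odd_double_half; case: (odd k) => /=; rewrite ?add0n ?add1n.
  rewrite exprS h /cos_coeff /sin_coeff /= odd_double/= doubleK exprS -?exprnP.
  by apply/eqP; rewrite eq_complex/=; apply/andP; split; apply/eqP; ring.
rewrite h /cos_coeff /sin_coeff /= odd_double/= doubleK -?exprnP.
by apply/eqP; rewrite eq_complex/=; apply/andP; split; apply/eqP; ring.
Qed.

Lemma cvg_taylor_exp z : taylor_exp ^~ z @ \oo --> cexp z.
Proof.
have -> : z = (complex.Re z)%:C + (0 +i* complex.Im z).
  by case: z => a b; apply/eqP; rewrite eq_complex/= addr0 add0r !eqxx.
rewrite cexpD; apply: taylor_exp_mul.
  rewrite /cexp/= cos0 sin0 mulr1 mulr0.
  apply: (complex_cvg_ext _ (complex_cvg_ReIm (is_cvg_series_exp_coeff (complex.Re z)) (@cvg_cst _ 0 _ _ _))) => // N.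
  rewrite /series/= /taylor_exp complexr0 rmorph_sum; apply: eq_bigr => k _.
  by rewrite rmorphM rmorphXn fmorphV rmorph_nat.
rewrite /cexp/= expR0 !mul1r.
have hc := @is_cvg_series_cos_coeff R (complex.Im z).
have hs := @is_cvg_series_sin_coeff R (complex.Im z).
rewrite cos.unlock sin.unlock.
apply: (complex_cvg_ext _ (complex_cvg_ReIm hc hs)) => // N.
rewrite /series/= /taylor_exp -sum_complex; apply: eq_bigr => k _.
by rewrite imaginary_exp_coeff.
Qed.

End cexp.

(** * Dirichlet convolution and exponential *)

Section dirichlet_convolution.
Context {K : pzRingType}.
Implicit Types (g h : nat -> K).

Definition dconv g h (m : nat) : K :=
  \sum_(1 <= i < m.+1) \sum_(1 <= j < m.+1 | (i * j == m)%N) g i * h j.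

Lemma dconv_widen g h m N : (0 < m < N)%N -> dconv g h m =
  \sum_(1 <= i < N) \sum_(1 <= j < N | (i * j == m)%N) g i * h j.
Proof.
move=> /andP[m0 mN]; rewrite /dconv (big_nat_widen _ _ N)//=.
rewrite big_mkcond/= !big_nat; apply: eq_bigr => i /andP[i1 iN].
case: ifPn => im.
  rewrite (big_nat_widen _ _ N)//=.
  rewrite big_nat_cond [RHS]big_nat_cond; apply: eq_bigl => j.
  case: (ltnP 0 j) => //= j1; case: (ltnP j N) => //= jN.
  case: eqP => //= ijm; rewrite ltnS -ijm leq_pmull//.
rewrite big_nat_cond big_pred0// => j; apply/negbTE/negP => /andP[/andP[j1 _] /eqP ijm].
by move/negP: im; apply; rewrite ltnS -ijm leq_pmulr.
Qed.

Lemma sum_dconv g h N : \sum_(1 <= m < N) dconv g h m =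
  \sum_(1 <= i < N) g i * \sum_(1 <= j < N | (i * j < N)%N) h j.
Proof.
rewrite big_nat (eq_bigr (fun m => \sum_(1 <= i < N)
  \sum_(1 <= j < N | (i * j == m)%N) g i * h j)); last first.
  by move=> m; exact: dconv_widen.
rewrite -big_nat exchange_big/= big_nat [RHS]big_nat; apply: eq_bigr => i /andP[i1 iN].
rewrite mulr_sumr (exchange_big_dep xpredT)//= [RHS]big_mkcond/=.
rewrite big_nat [RHS]big_nat; apply: eq_bigr => j /andP[j1 jN].
under eq_bigl do rewrite eq_sym.
by rewrite big_nat1_eq muln_gt0 i1 j1.
Qed.

Fixpoint dpow g (k : nat) : nat -> K :=
  if k is k'.+1 then dconv g (dpow g k') else fun m => (m == 1%N)%:R.

Lemma dconv_eq0 g h (S : pred nat) m :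
  (forall i j, (0 < i)%N -> (0 < j)%N -> S i -> S j -> S (i * j)%N) ->
  (forall i, (0 < i)%N -> ~~ S i -> g i = 0) ->
  (forall i, (0 < i)%N -> ~~ S i -> h i = 0) ->
  ~~ S m -> dconv g h m = 0.
Proof.
move=> SM g0 h0 Sm; rewrite /dconv big_nat big1// => i /andP[i1 _].
rewrite big_nat_cond big1// => j /andP[/andP[j1 _] /eqP ijm].
have [Si|Si] := boolP (S i); last by rewrite g0// mul0r.
have [Sj|Sj] := boolP (S j); last by rewrite h0// mulr0.
by move/negP: Sm; case; rewrite -ijm SM.
Qed.

Lemma dpow_eq0 g (S : pred nat) k m : S 1%N ->
  (forall i j, (0 < i)%N -> (0 < j)%N -> S i -> S j -> S (i * j)%N) ->
  (forall i, (0 < i)%N -> ~~ S i -> g i = 0) ->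
  ~~ S m -> dpow g k m = 0.
Proof.
move=> S1 SM g0; elim: k m => [m|k IH m] Sm /=.
  by case: eqP => // m1; rewrite m1 S1 in Sm.
by apply: (dconv_eq0 SM g0) => // i _; exact: IH.
Qed.

(** A product of [k] integers greater than [1] is at least [2 ^ k]. *)
Lemma dpow_small g k m : g 1%N = 0 -> (0 < m < 2 ^ k)%N -> dpow g k m = 0.
Proof.
move=> g1; elim: k m => [m|k IH m] /andP[m0 m2].
  by move: m2; rewrite expn0 ltnNge m0.
rewrite /= /dconv big_nat big1// => i /andP[i1 _].
rewrite big_nat_cond big1// => j /andP[/andP[j1 _] /eqP ijm].
have [i2|] := leqP 2 i; last first.
  by case: i i1 ijm => // -[|//] _ _ _; rewrite g1 mul0r.
rewrite IH ?mulr0// j1/= -(@ltn_pmul2l 2)// -expnS (leq_ltn_trans _ m2)//.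
by rewrite -ijm leq_mul2r i2 orbT.
Qed.

End dirichlet_convolution.

Lemma dconv_mul_char {K : comPzRingType} (g h chi : nat -> K) m :
  (forall i j, (0 < i)%N -> (0 < j)%N -> chi (i * j)%N = chi i * chi j) ->
  dconv (fun i => g i * chi i) (fun i => h i * chi i) m = dconv g h m * chi m.
Proof.
move=> chiM; rewrite /dconv mulr_suml big_nat [RHS]big_nat; apply: eq_bigr => i /andP[i1 _].
rewrite mulr_suml big_nat_cond [RHS]big_nat_cond.
apply: eq_bigr => j /andP[/andP[j1 _] /eqP <-].
by rewrite chiM//; ring.
Qed.

Lemma dpow_mul_char {K : comPzRingType} (g chi : nat -> K) k m :
  chi 1%N = 1 ->
  (forall i j, (0 < i)%N -> (0 < j)%N -> chi (i * j)%N = chi i * chi j) ->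
  dpow (fun i => g i * chi i) k m = dpow g k m * chi m.
Proof.
move=> chi1 chiM; elim: k m => [m|k IH m] /=.
  by case: eqP => [->|]; rewrite ?chi1 ?mulr1// mul0r.
by rewrite (funext IH) dconv_mul_char.
Qed.

Section dirichlet_product.
Context {R : realType}.
Implicit Types (g h : nat -> R[i]).

Lemma normc_dconv g h m :
  normc (dconv g h m) <= dconv (fun i => normc (g i)) (fun i => normc (h i)) m.
Proof.
apply: le_trans (normc_sum _ _ _) _; apply: ler_sum => i _.
apply: le_trans (normc_sum _ _ _) _; apply: ler_sum => j _.
by rewrite normcM.
Qed.

Lemma sum_dconv_le g h (B C : R) N :
  (forall N, \sum_(1 <= i < N) normc (g i) <= B) ->
  (forall N, \sum_(1 <= i < N) normc (h i) <= C) ->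
  \sum_(1 <= i < N) normc (dconv g h i) <= B * C.
Proof.
move=> gB hC.
apply: (@le_trans _ _ (\sum_(1 <= m < N)
    dconv (fun i => normc (g i)) (fun i => normc (h i)) m)).
  by apply: ler_sum => m _; exact: normc_dconv.
rewrite sum_dconv.
apply: (@le_trans _ _ (\sum_(1 <= i < N) normc (g i) * C)).
  apply: ler_sum => i _; rewrite ler_wpM2l ?normc_ge0//.
  apply: le_trans (hC N); rewrite big_mkcond; apply: ler_sum => j _.
  by case: ifP; rewrite ?normc_ge0.
rewrite -mulr_suml ler_wpM2r//.
by have := hC 0%N; rewrite big_geq.
Qed.

(** The condition [i * j < N] only bounds [j] by a quantity growing with [N]. *)
Lemma cvg_sum_mul_lt h (y : R[i]) i : (0 < i)%N ->
  (fun N => \sum_(1 <= j < N) h j) @ \oo --> y ->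
  (fun N => \sum_(1 <= j < N | (i * j < N)%N) h j) @ \oo --> y.
Proof.
move=> i0 /complex_cvgP hy; apply/complex_cvgP => e /hy [A _ hA].
exists (i * A).+1 => // N /= iAN.
have N0 : (0 < N)%N by exact: leq_trans iAN.
rewrite (_ : \sum_(_ <= _ < _ | _) _ = \sum_(1 <= j < (N.-1 %/ i).+1) h j).
  by apply: hA; rewrite /= ltnW// ltnS leq_divRL// mulnC -ltnS prednK.
rewrite [RHS](big_nat_widen _ _ N)/=; last first.
  by apply: leq_ltn_trans (leq_div _ _) _; rewrite ltn_predL.
by apply: eq_bigl => j; rewrite -{1}(prednK N0) !ltnS leq_divRL// mulnC.
Qed.

(** For fixed [i] the inner sum over [i * j < N] tends to [y] as [N] grows, and
    it is bounded by [C], so the outer sum is covered by dominated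
    convergence. *)
Lemma cvg_dconv g h (B C : R) (x y : R[i]) :
  (forall N, \sum_(1 <= i < N) normc (g i) <= B) ->
  (forall N, \sum_(1 <= i < N) normc (h i) <= C) ->
  (fun N => \sum_(1 <= i < N) g i) @ \oo --> x ->
  (fun N => \sum_(1 <= i < N) h i) @ \oo --> y ->
  (fun N => \sum_(1 <= i < N) dconv g h i) @ \oo --> x * y.
Proof.
move=> gB hC gx hy; have C0 : 0 <= C by have := hC 0%N; rewrite big_geq.
rewrite (funext (sum_dconv g h)).
apply: (@tannery _ _ (fun i => g i * y) (fun i => normc (g i) * C) _ (B * C)).
- move=> i i1; apply: seq_cvgM; first exact: cvg_cst.
  exact: cvg_sum_mul_lt.
- move=> N i i1; rewrite normcM ler_wpM2l ?normc_ge0//.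
  apply: le_trans (normc_sum _ _ _) _.
  apply: le_trans (hC N); rewrite big_mkcond; apply: ler_sum => j _.
  by case: ifP; rewrite ?normc_ge0.
- by move=> i; rewrite mulr_ge0 ?normc_ge0.
- by move=> N; rewrite -mulr_suml ler_wpM2r.
rewrite (_ : (fun N => _) = fun N => (\sum_(1 <= i < N) g i) * y); last first.
  by apply/funext => N; rewrite mulr_suml.
by apply: seq_cvgM; [exact: gx | exact: cvg_cst].
Qed.

Lemma sum_delta1 N (a : R[i]) :
  \sum_(1 <= i < N) (i == 1%N)%:R * a = (1 < N)%N%:R * a.
Proof.
have [N1|N1] := ltnP 1 N; last by rewrite big_geq// mul0r.
rewrite big_ltn//= big_nat big1 ?addr0// => i /andP[i2 _].
by rewrite gtn_eqF// mul0r.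
Qed.

Lemma sum_dpow_le g (B : R) k N :
  (forall N, \sum_(1 <= i < N) normc (g i) <= B) ->
  \sum_(1 <= i < N) normc (dpow g k i) <= B ^+ k.
Proof.
move=> gB; elim: k N => [N|k IH N]; last by rewrite exprS; exact: sum_dconv_le.
rewrite expr0; have [N1|N1] := ltnP 1 N; last by rewrite big_geq.
rewrite big_ltn// (_ : dpow g 0 1%N = 1)// normc1 big_nat big1 ?addr0// => i /andP[i2 _].
by rewrite /dpow gtn_eqF// normc0.
Qed.

Lemma cvg_dpow g (B : R) (x : R[i]) k :
  (forall N, \sum_(1 <= i < N) normc (g i) <= B) ->
  (fun N => \sum_(1 <= i < N) g i) @ \oo --> x ->
  (fun N => \sum_(1 <= i < N) dpow g k i) @ \oo --> x ^+ k.
Proof.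
move=> gB gx; elim: k => [|k IH].
  apply/complex_cvgP => e e0; exists 2%N => // N /= N2.
  under eq_bigr do rewrite -[_%:R]mulr1.
  by rewrite sum_delta1 N2 mulr1 expr0 subrr normc0 ltW.
by rewrite exprS; apply: (cvg_dconv gB (fun N => sum_dpow_le k N gB) gx IH).
Qed.

(** The exponential of [g] for Dirichlet convolution.  Stopping at [k < m] loses
    nothing when [g 1 = 0], since the [k]-th power then vanishes at all
    [m < 2 ^ k]. *)
Definition dexp g m : R[i] := \sum_(0 <= k < m) dpow g k m / k`!%:R.

Lemma dexp_widen g m N : g 1%N = 0 -> (0 < m <= N)%N ->
  dexp g m = \sum_(0 <= k < N) dpow g k m / k`!%:R.
Proof.
move=> g1 /andP[m0 mN]; rewrite [RHS](@big_cat_nat _ _ _ m)//=.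
rewrite [X in _ = _ + X]big_nat [X in _ = _ + X]big1 ?addr0// => k /andP[mk _].
by rewrite dpow_small ?mul0r// m0 (leq_ltn_trans mk)// ltn_expl.
Qed.

(** The truncation [k < m] in the coefficients may be relaxed to [k < N], so
    that a partial sum of the exponential is exactly a truncated exponential
    series of partial sums. *)
Lemma sum_dexp g N : g 1%N = 0 -> \sum_(1 <= m < N) dexp g m =
  \sum_(0 <= k < N) (\sum_(1 <= m < N) dpow g k m) / k`!%:R.
Proof.
move=> g1; rewrite big_nat (eq_bigr (fun m => \sum_(0 <= k < N) dpow g k m / k`!%:R)).
  by rewrite -big_nat exchange_big/=; apply: eq_bigr => k _; rewrite mulr_suml.
by move=> m /andP[m0 mN]; rewrite (@dexp_widen _ _ N)// m0 ltnW.
Qed.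

Lemma cvg_dexp g (B : R) (x : R[i]) : g 1%N = 0 ->
  (forall N, \sum_(1 <= i < N) normc (g i) <= B) ->
  (fun N => \sum_(1 <= i < N) g i) @ \oo --> x ->
  (fun N => \sum_(1 <= i < N) dexp g i) @ \oo --> cexp x.
Proof.
move=> g1 gB gx; have B0 : 0 <= B by have := gB 0%N; rewrite big_geq.
rewrite (funext (fun N => sum_dexp N g1)).
apply: (@tannery _ _ (fun k => x ^+ k / k`!%:R) (fun k => B ^+ k / k`!%:R)
  _ (expR B)).
- by move=> k _; apply: seq_cvgM; [exact: cvg_dpow gB gx | exact: cvg_cst].
- move=> N k _; rewrite normcM normc_fact ler_wpM2r//.
  exact: le_trans (normc_sum _ _ _) (sum_dpow_le _ _ gB).
- by move=> k; rewrite divr_ge0// exprn_ge0.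
- by move=> N; exact: exp_sum_le.
exact: cvg_taylor_exp.
Qed.

Lemma sum_dexp_le g (B : R) N : g 1%N = 0 ->
  (forall N, \sum_(1 <= i < N) normc (g i) <= B) ->
  \sum_(1 <= i < N) normc (dexp g i) <= expR B.
Proof.
move=> g1 gB; have B0 : 0 <= B by have := gB 0%N; rewrite big_geq.
apply: (@le_trans _ _ (\sum_(1 <= m < N) \sum_(0 <= k < N) normc (dpow g k m) / k`!%:R)).
  rewrite big_nat [leRHS]big_nat; apply: ler_sum => m /andP[m0 mN].
  rewrite (@dexp_widen _ _ N)// ?m0 ?(ltnW mN)//.
  apply: le_trans (normc_sum _ _ _) _; apply: ler_sum => k _.
  by rewrite normcM normc_fact.
rewrite exchange_big/=; apply: le_trans (exp_sum_le N B0).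
apply: ler_sum => k _; rewrite -mulr_suml ler_wpM2r//.
exact: sum_dpow_le.
Qed.

Lemma dexp_mul_char g (chi : nat -> R[i]) m : chi 1%N = 1 ->
  (forall i j, (0 < i)%N -> (0 < j)%N -> chi (i * j)%N = chi i * chi j) ->
  dexp (fun i => g i * chi i) m = dexp g m * chi m.
Proof.
move=> chi1 chiM; rewrite /dexp mulr_suml; apply: eq_bigr => k _.
by rewrite dpow_mul_char// mulrAC.
Qed.

Lemma dexp_eq0 g (S : pred nat) m : S 1%N ->
  (forall i j, (0 < i)%N -> (0 < j)%N -> S i -> S j -> S (i * j)%N) ->
  (forall i, (0 < i)%N -> ~~ S i -> g i = 0) ->
  ~~ S m -> dexp g m = 0.
Proof.
move=> S1 SM g0 Sm; rewrite /dexp big1// => k _.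
by rewrite (dpow_eq0 _ S1 SM g0 Sm) mul0r.
Qed.

End dirichlet_product.

(** * Complex powers and uniqueness of Dirichlet coefficients *)

Section natpow_theory.
Context {R : realType}.
Implicit Types (s z w : R[i]) (a b c : nat -> R[i]).

Lemma natpowE n z : natpow n z = cexp (z * (ln n%:R)%:C).
Proof.
by case: z => x y; rewrite /natpow /cexp/= !mulr0 subr0 add0r.
Qed.

Lemma natpowD n z w : natpow n (z + w) = natpow n z * natpow n w.
Proof. by rewrite !natpowE mulrDl cexpD. Qed.

Lemma natpow0 n : natpow n (0 : R[i]) = 1.
Proof. by rewrite natpowE mul0r cexp0. Qed.

Lemma natpow1 z : natpow 1 z = 1.
Proof. by rewrite natpowE ln1 mulr0 cexp0. Qed.

Lemma natpowM z i j : (0 < i)%N -> (0 < j)%N ->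
  natpow (i * j) z = natpow i z * natpow j z.
Proof.
move=> i0 j0; rewrite !natpowE natrM lnM ?posrE ?ltr0n//.
by rewrite rmorphD/= mulrDr cexpD.
Qed.

Lemma natpow_expn z n k : (0 < n)%N -> natpow (n ^ k) z = natpow n (k%:R * z).
Proof.
move=> n0; elim: k => [|k IH]; first by rewrite expn0 natpow1 mul0r natpow0.
by rewrite expnS natpowM ?expn_gt0 ?n0// IH -natpowD -[in RHS]natr1 mulrDl mul1r addrC.
Qed.

Lemma normc_natpow n z : (0 < n)%N -> normc (natpow n z) = n%:R `^ complex.Re z.
Proof.
move=> n0; rewrite natpowE normc_cexp /powR pnatr_eq0 gtn_eqF//.
by case: z => x y /=; rewrite mulr0 subr0.
Qed.

Lemma natpow_neq0 n z : natpow n z != 0.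
Proof.
apply/eqP => n0; have := natpowD n z (- z).
by rewrite subrr natpow0 n0 mul0r => /eqP; rewrite oner_eq0.
Qed.

Definition abs_conv b s := exists B : R, forall N,
  \sum_(1 <= m < N) normc (b m * natpow m (- s)) <= B.

(** The first nonzero term would dominate the others as the argument [2 + k]
    grows: the terms after the [n]-th decay at least like
    [(n.+1)^(-k)] against [n^(-k)]. *)
Lemma dirichlet_unique a : abs_conv a 2 ->
  (forall k : nat, dirichlet_sum a ^~ (2 + k%:R) @ \oo --> (0 : R[i])) ->
  forall m, (0 < m)%N -> a m = 0.
Proof.
move=> [B aB] a0 m; elim/ltn_ind : m => n IH n0.
have nS0 : (0 : R) < n.+1%:R by rewrite ltr0n.
have nR0 : (0 : R) < n%:R by rewrite ltr0n.
pose x := normc (a n * natpow n (-2)).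
have pw m k : (0 < m)%N ->
    normc (a m * natpow m (- (2 + k%:R))) = normc (a m * natpow m (-2)) * (m%:R^-1) ^+ k.
  move=> m0; rewrite opprD natpowD mulrA normcM; congr (_ * _).
  rewrite normc_natpow// -[k%:R](rmorph_nat (real_complex R)) -rmorphN/=.
  by rewrite powRN powR_mulrn// exprVn.
suff x0 : x <= 0.
  have : x = 0 by apply/eqP; rewrite eq_le x0 normc_ge0.
  move/eq0_normc => /eqP; rewrite mulf_eq0 (negbTE (natpow_neq0 _ _)) orbF.
  by move/eqP.
(* [x] is the modulus of the [n]-th term at [2], the first one that may not
   vanish. *)
have xk k : x <= B * (n%:R / n.+1%:R) ^+ k.
  have xB : x * (n%:R^-1) ^+ k <= B * (n.+1%:R^-1) ^+ k.
    rewrite /x -pw//.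
    have lim_a : (fun N => dirichlet_sum a N (2 + k%:R) - a n * natpow n (- (2 + k%:R))) @ \oo
        --> 0 - a n * natpow n (- (2 + k%:R)).
      by apply: seq_cvgB; [exact: a0 | exact: cvg_cst].
    rewrite -normcN -sub0r; apply: (normc_lim_le lim_a).
    exists n.+1 => // N /= nN.
    rewrite /dirichlet_sum (@big_cat_nat _ _ _ n.+1)//= big_nat_recr//=.
    rewrite (_ : \sum_(1 <= i < n) _ = 0) ?add0r; last first.
      by rewrite big_nat big1// => i /andP[i0 iN]; rewrite IH// mul0r.
    rewrite addrAC subrr add0r; apply: le_trans (normc_sum _ _ _) _.
    apply: (@le_trans _ _ (\sum_(n.+1 <= i < N) normc (a i * natpow i (-2)) * (n.+1%:R^-1) ^+ k)).
      rewrite big_nat [leRHS]big_nat; apply: ler_sum => i /andP[ni _].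
      have i0 := leq_ltn_trans (leq0n _) ni.
      rewrite pw// ler_wpM2l ?normc_ge0// lerXn2r// ?nnegrE ?invr_ge0//.
      by rewrite lef_pV2 ?posrE ?ltr0n// ler_nat.
    rewrite -mulr_suml ler_wpM2r ?exprn_ge0 ?invr_ge0//.
    apply: le_trans (aB N); rewrite [leRHS](@big_cat_nat _ _ _ n.+1)//= lerDr.
    by apply: sumr_ge0 => i _; exact: normc_ge0.
  have : x * n%:R^-1 ^+ k * n%:R ^+ k <= B * n.+1%:R^-1 ^+ k * n%:R ^+ k.
    by rewrite ler_wpM2r ?exprn_ge0.
  by rewrite -!mulrA -!exprMn mulVf ?gt_eqF// expr1n mulr1 [_^-1 * _]mulrC.
have q1 : `|n%:R / n.+1%:R| < 1 :> R.
  by rewrite ger0_norm ?divr_ge0// ltr_pdivrMr// mul1r ltr_nat.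
have qk : (fun k => B * (n%:R / n.+1%:R) ^+ k) @ \oo --> (0 : R).
  by rewrite -(mulr0 B); apply: seq_cvgM; [exact: cvg_cst | exact: cvg_expr].
rewrite -(seq_lim qk); apply: limr_ge; first by apply: cvgP qk.
by near=> k; exact: xk.
Unshelve. all: by end_near. Qed.

End natpow_theory.

(** * Smooth integers *)

Lemma max_pdivM P i j : (0 < i)%N -> (0 < j)%N ->
  (max_pdiv i <= P)%N -> (max_pdiv j <= P)%N -> (max_pdiv (i * j) <= P)%N.
Proof.
move=> i0 j0 iP jP.
have [ij1|ij1] := leqP (i * j) 1.
  by rewrite (leq_trans (max_pdiv_leq _)) ?muln_gt0 ?i0// (leq_trans ij1)// (leq_trans _ iP)// max_pdiv_gt0.
have pr := max_pdiv_prime ij1.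
have := max_pdiv_dvd (i * j); rewrite Euclid_dvdM// => /orP[] d.
  by apply: leq_trans iP; apply: max_pdiv_max; rewrite mem_primes pr i0.
by apply: leq_trans jP; apply: max_pdiv_max; rewrite mem_primes pr j0.
Qed.

Lemma max_pdiv_le_dvdn d n : (0 < n)%N -> (d %| n)%N -> (max_pdiv d <= max_pdiv n)%N.
Proof.
move=> n0 dn; have [d1|d1] := leqP d 1.
  have d0 : (0 < d)%N by exact: dvdn_gt0 dn.
  by rewrite (leq_trans (max_pdiv_leq d0))// (leq_trans d1)// max_pdiv_gt0.
apply: max_pdiv_max; rewrite mem_primes max_pdiv_prime//= n0.
exact: dvdn_trans (max_pdiv_dvd d) dn.
Qed.

Section smooth_numbers.
Context {R : realType}.

(** Euler product in the form of an induction: splitting the [q]-smooth integers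
    by divisibility by [q] gives [S_q <= S_(q-1) + q^(-x) S_q] for the partial
    sums, and [q^(-x) < 1]. *)
Lemma smooth_sum_bounded (x : R) P : 0 < x -> exists B : R, forall N,
  \sum_(1 <= n < N | (max_pdiv n <= P)%N) n%:R `^ (- x) <= B.
Proof.
move=> x0; pose S P N : R := \sum_(1 <= n < N | (max_pdiv n <= P)%N) n%:R `^ (- x).
suff h Q : exists B : R, forall N, S Q.+1 N <= B.
  have [B hB] := h P; exists B => N; apply: le_trans (hB N).
  rewrite /S big_mkcond [leRHS]big_mkcond; apply: ler_sum => n _.
  have [nP|nP] := leqP (max_pdiv n) P; first by rewrite leqW.
  by case: ifP => // _; exact: powR_ge0.
elim: Q => [|Q [B IH]].
  exists 1 => N; rewrite /S big_nat_cond.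
  rewrite (eq_bigl (fun n => (n == 1%N) && (1 < N)%N)).
    have [N1|N1] := ltnP 1 N; last by rewrite big_pred0 ?ler01// => n; rewrite andbF.
    under eq_bigl do rewrite andbT.
    by rewrite big_nat1_eq N1 powR1.
  move=> n; apply/idP/idP => [/andP[/andP[n1 nN] mn]|/andP[/eqP -> ->]//].
  have n_le1 : (n <= 1)%N.
    rewrite leqNgt; apply/negP => n2; have := prime_gt1 (max_pdiv_prime n2).
    by rewrite ltnNge mn.
  have -> : n = 1%N by apply/eqP; rewrite eqn_leq n_le1.
  by rewrite (leq_trans _ nN)// ltnS.
pose q := Q.+2; pose r : R := q%:R `^ (- x).
have q0 : (0 : R) < q%:R by rewrite ltr0n.
have r1 : r < 1.
  rewrite /r /powR gt_eqF// -[ltRHS]expR0 ltr_expR mulNr oppr_lt0 mulr_gt0//.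
  by rewrite ln_gt0// ltr1n.
exists (B / (1 - r)) => N; rewrite ler_pdivlMr ?subr_gt0//.
suff : S q N <= S Q.+1 N + r * S q N.
  by have := IH N; rewrite -/q mulrBr mulr1 [_ * r]mulrC; lra.
rewrite {1}/S (bigID (fun n => q %| n)%N)/= addrC lerD//.
  rewrite /S big_nat_cond [leRHS]big_nat_cond big_mkcond [leRHS]big_mkcond.
  apply: ler_sum => n _; case: ifP; last by case: ifP => // _ _; exact: powR_ge0.
  move=> /andP[/andP[n0 nN] /andP[nq qn]]; rewrite n0 nN/=.
  case: ifPn => //; rewrite -ltnNge => Qn; exfalso.
  have e : max_pdiv n = q by apply/eqP; rewrite eqn_leq nq.
  by move: qn; rewrite -e max_pdiv_dvd.
(* Multiples of [q] are reindexed as [q * k] by summing over all pairs. *)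
apply: (@le_trans _ _ (\sum_(1 <= n < N | (max_pdiv n <= q)%N)
    \sum_(1 <= k < N | (q * k == n)%N) n%:R `^ (- x))).
  rewrite [leRHS](bigID (fun n => q %| n)%N)/=.
  rewrite -[leLHS]addr0 lerD//; last first.
    by apply: sumr_ge0 => n _; apply: sumr_ge0 => k _; exact: powR_ge0.
  rewrite big_nat_cond [leRHS]big_nat_cond; apply: ler_sum => n /andP[/andP[n0 nN] /andP[_ qn]].
  rewrite (eq_bigl (fun k => k == n %/ q)%N).
    rewrite big_nat1_eq divn_gt0// dvdn_leq//= (leq_ltn_trans (leq_div _ _))//.
  by move=> k; rewrite eqn_div// mulnC.
rewrite (exchange_big_dep xpredT)//= mulr_sumr [leRHS]big_mkcond/=.
rewrite big_nat [leRHS]big_nat; apply: ler_sum => k /andP[k0 kN].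
under eq_bigl do rewrite eq_sym.
rewrite big_nat1_cond_eq.
case: ifP => [/andP[_ qk]|_]; last first.
  by case: ifP => // _; rewrite mulr_ge0 ?powR_ge0.
rewrite (leq_trans (max_pdiv_le_dvdn _ (dvdn_mull q (dvdnn k))) qk) ?muln_gt0//.
by rewrite natrM powRM ?ler0n.
Qed.

End smooth_numbers.

(** * Dirichlet series over smooth integers *)

Section smooth_series.
Context {R : realType} (P : nat).
Implicit Types (a b c : nat -> R[i]) (F G : R[i] -> R[i]).

(** The same coefficients serve at every [s], so they are determined by the values
    of [F] far to the right and in turn give [F] up to the imaginary axis. *)
Definition smooth_series F := exists2 b,
  (forall m, (0 < m)%N -> (P < max_pdiv m)%N -> b m = 0) &
  forall s, half_plane 0 s -> abs_conv b s /\ dirichlet_sum b ^~ s @ \oo --> F s.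

Lemma smooth_series0 : smooth_series (fun=> 0).
Proof.
exists (fun=> 0) => // s _; split.
  by exists 0 => N; rewrite big1// => m _; rewrite mul0r normc0.
rewrite (_ : dirichlet_sum _ ^~ s = fun=> 0); first exact: cvg_cst.
by apply/funext => N; rewrite /dirichlet_sum big1// => m _; rewrite mul0r.
Qed.

Lemma smooth_seriesD F G : smooth_series F -> smooth_series G ->
  smooth_series (fun s => F s + G s).
Proof.
move=> [a a0 aF] [b b0 bG]; exists (fun m => a m + b m).
  by move=> m m0 mP; rewrite a0// b0// addr0.
move=> s s0; have [[A aA] {}aF] := aF s s0; have [[B bB] {}bG] := bG s s0.
split.
  exists (A + B) => N; apply: le_trans (lerD (aA N) (bB N)).
  rewrite -big_split/=; apply: ler_sum => m _; rewrite mulrDl; exact: normcD.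
rewrite (_ : dirichlet_sum _ ^~ s = fun N => dirichlet_sum a N s + dirichlet_sum b N s).
  exact: seq_cvgD aF bG.
by apply/funext => N; rewrite /dirichlet_sum -big_split/=; apply: eq_bigr => m _; rewrite mulrDl.
Qed.

Lemma smooth_seriesM F G : smooth_series F -> smooth_series G ->
  smooth_series (fun s => F s * G s).
Proof.
move=> [a a0 aF] [b b0 bG]; exists (dconv a b).
  move=> m m0; rewrite ltnNge; apply: (dconv_eq0 (S := fun m => (max_pdiv m <= P)%N)).
  - exact: max_pdivM.
  - by move=> i i0; rewrite -ltnNge; exact: a0.
  - by move=> i i0; rewrite -ltnNge; exact: b0.
move=> s s0; have [[A aA] {}aF] := aF s s0; have [[B bB] {}bG] := bG s s0.
have chiM i j : (0 < i)%N -> (0 < j)%N ->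
  natpow (i * j) (- s) = natpow i (- s) * natpow j (- s) by exact: natpowM.
have E m := esym (@dconv_mul_char _ a b (fun m => natpow m (- s)) m chiM).
split.
  exists (A * B) => N; under eq_bigr do rewrite E.
  exact: sum_dconv_le.
rewrite /dirichlet_sum; under eq_fun do under eq_bigr do rewrite E.
exact: cvg_dconv aA bB aF bG.
Qed.

Lemma smooth_series_cst (z : R[i]) : (0 < P)%N -> smooth_series (fun=> z).
Proof.
move=> P0; exists (fun m => (m == 1%N)%:R * z).
  move=> m m0 mP; case: eqP mP => [->|_ _]; last by rewrite mul0r.
  by rewrite [max_pdiv 1]/= ltnNge P0.
move=> s _.
have e N : (1 < N)%N -> dirichlet_sum (fun m => (m == 1%N)%:R * z) N s = z.
  move=> N1; rewrite /dirichlet_sum big_ltn//= natpow1 mulr1 mul1r big_nat big1 ?addr0//.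
  by move=> m /andP[m2 _]; rewrite gtn_eqF// !mul0r.
split.
  exists (normc z) => N; have [N1|N1] := ltnP 1 N; last by rewrite big_geq ?normc_ge0.
  rewrite big_ltn//= natpow1 mulr1 mul1r big_nat big1 ?addr0//.
  by move=> m /andP[m2 _]; rewrite gtn_eqF// !mul0r normc0.
apply/complex_cvgP => x x0; exists 2%N => // N /= N2.
by rewrite e// subrr normc0 ltW.
Qed.

Lemma smooth_series_natpow n : (0 < n)%N -> (max_pdiv n <= P)%N ->
  smooth_series (fun s => natpow n (- s)).
Proof.
move=> n0 nP; exists (fun m => (m == n)%:R).
  move=> m m0 mP; case: eqP mP => [->|//].
  by rewrite ltnNge nP.
move=> s _.
have e (N : nat) (f : nat -> R[i]) : (n < N)%N ->
    \sum_(1 <= m < N) (m == n)%:R * f m = f n.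
  move=> nN; rewrite (eq_bigr (fun m => if m == n then f m else 0)).
    by rewrite -big_mkcond big_nat1_eq n0 nN.
  by move=> m _; case: eqP; rewrite ?mul1r ?mul0r.
split.
  exists (normc (natpow n (- s))) => N.
  rewrite (eq_bigr (fun m => if m == n then normc (natpow m (- s)) else 0)).
    rewrite -big_mkcond big_nat1_eq; case: ifP => // _; exact: normc_ge0.
  by move=> m _; case: eqP; rewrite ?mul1r ?mul0r ?normc0.
apply/complex_cvgP => x x0; exists n.+1 => // N /= nN.
by rewrite /dirichlet_sum e// subrr normc0 ltW.
Qed.

(** The coefficient at [1] contributes the constant factor [cexp (b 1)]; the rest
    of the series has an exponential for Dirichlet convolution. *)
Lemma smooth_series_exp F : (0 < P)%N -> smooth_series F ->
  smooth_series (fun s => cexp (F s)).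
Proof.
move=> P0 [b b0 bF]; pose g m := if m == 1%N then 0 else b m.
suff h : smooth_series (fun s => cexp (F s - b 1%N)).
  rewrite (_ : (fun s => _) = fun s => cexp (F s - b 1%N) * cexp (b 1%N)).
    exact: smooth_seriesM h (smooth_series_cst _ P0).
  by apply/funext => s; rewrite -cexpD subrK.
exists (dexp g).
  move=> m m0; rewrite ltnNge; apply: (dexp_eq0 (S := fun m => (max_pdiv m <= P)%N)).
  - by rewrite [max_pdiv 1]/=.
  - exact: max_pdivM.
  - move=> i i0; rewrite -ltnNge /g; case: ifP => // _; exact: b0.
move=> s s0; have [[B bB] {}bF] := bF s s0.
have chiM i j : (0 < i)%N -> (0 < j)%N ->
  natpow (i * j) (- s) = natpow i (- s) * natpow j (- s) by exact: natpowM.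
have chi1 := natpow1 (- s).
have g1 : g 1%N * natpow 1 (- s) = 0 by rewrite /g mul0r.
have gB N : \sum_(1 <= m < N) normc (g m * natpow m (- s)) <= B.
  apply: le_trans (bB N); apply: ler_sum => m _; rewrite /g.
  by case: ifP => // _; rewrite mul0r normc0 normc_ge0.
have gF : (fun N => \sum_(1 <= m < N) g m * natpow m (- s)) @ \oo --> F s - b 1%N.
  have : (fun N => dirichlet_sum b N s - b 1%N) @ \oo --> F s - b 1%N.
    by apply: seq_cvgB; [exact: bF | exact: cvg_cst].
  move=> /complex_cvgP h; apply/complex_cvgP => e /h [A _ hA]; exists A.+2 => // N /= AN.
  have N1 : (1 < N)%N by exact: leq_trans AN.
  suff -> : \sum_(1 <= m < N) g m * natpow m (- s) = dirichlet_sum b N s - b 1%N.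
    exact: hA (ltnW (ltnW AN)).
  rewrite /dirichlet_sum (big_ltn N1) [in RHS](big_ltn N1).
  rewrite {1}/g mul0r add0r natpow1 mulr1 (addrC (b 1%N)) addrK.
  by rewrite big_nat [RHS]big_nat; apply: eq_bigr => m /andP[m2 _]; rewrite /g gtn_eqF.
(* The factors [m^(-s)] are completely multiplicative, so they can be absorbed
   in the coefficients before exponentiating. *)
have E m := esym (@dexp_mul_char _ g (fun m => natpow m (- s)) m chi1 chiM).
split.
  exists (expR B) => N; under eq_bigr do rewrite E.
  exact: sum_dexp_le.
rewrite /dirichlet_sum; under eq_fun do under eq_bigr do rewrite E.
exact: cvg_dexp g1 gB gF.
Qed.

(** The terms at [Re s / 2] are bounded, so those at [s] are [O(n^(- Re s / 2))],
    which is summable over smooth integers. *)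
Lemma smooth_series_of_cvg c F :
  (forall m, (0 < m)%N -> (P < max_pdiv m)%N -> c m = 0) ->
  (forall s, half_plane 0 s -> dirichlet_sum c ^~ s @ \oo --> F s) ->
  smooth_series F.
Proof.
move=> c0 cF; exists c => // s s0; split; last exact: cF.
rewrite /half_plane/= in s0.
pose x := complex.Re s / 2.
have x0 : 0 < x by rewrite divr_gt0.
have [C hC] : exists C : R, forall m, (0 < m)%N -> normc (c m) * m%:R `^ (- x) <= C.
  have hx : half_plane 0 x%:C by rewrite /half_plane/=.
  have nx m : (0 < m)%N -> normc (c m) * m%:R `^ (- x) = normc (c m * natpow m (- x%:C)).
    by move=> m0; rewrite normcM normc_natpow.
  have /complex_cvgP/(_ _ ltr01) [A _ hA] := cF _ hx.
  exists (2 + \sum_(1 <= m < A) normc (c m * natpow m (- x%:C))) => m m0.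
  rewrite nx//; have [mA|Am] := ltnP m A.
    rewrite (bigD1_seq m)//= ?mem_index_iota ?m0 ?iota_uniq//.
    rewrite addrCA lerDl addr_ge0// sumr_ge0// => i _; exact: normc_ge0.
  apply: le_trans (_ : 2 <= _); last first.
    by rewrite lerDl sumr_ge0// => i _; exact: normc_ge0.
  have e : c m * natpow m (- x%:C) =
      (dirichlet_sum c m.+1 x%:C - F x%:C) - (dirichlet_sum c m x%:C - F x%:C).
    by rewrite /dirichlet_sum big_nat_recr//=; ring.
  rewrite e; apply: le_trans (normcD _ _) _; rewrite normcN.
  by rewrite -[leRHS]/(1 + 1) lerD//; apply: hA => //=; exact: leqW.
have [B hB] := smooth_sum_bounded P x0.
have C0 : 0 <= C.
  by apply: le_trans (hC 1%N _) => //; rewrite mulr_ge0 ?normc_ge0 ?powR_ge0.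
exists (C * B) => N; apply: (@le_trans _ _ (C * \sum_(1 <= n < N | (max_pdiv n <= P)%N) n%:R `^ (- x))); last by rewrite ler_wpM2l.
rewrite mulr_sumr [leRHS]big_mkcond/= [leLHS]big_nat [leRHS]big_nat.
apply: ler_sum => m /andP[m0 _]; case: leqP => mP; last by rewrite c0// mul0r normc0.
rewrite normcM normc_natpow// (_ : complex.Re (- s) = - x + - x); last first.
  by rewrite /x; case: (s) => u v /=; lra.
rewrite powRD; last by rewrite pnatr_eq0 gtn_eqF ?implybT.
by rewrite mulrA ler_wpM2r ?powR_ge0 ?hC.
Qed.

Lemma smooth_series_sum (I : Type) (r : seq I) (Q : pred I) (F : I -> R[i] -> R[i]) :
  (forall i, Q i -> smooth_series (F i)) ->
  smooth_series (fun s => \sum_(i <- r | Q i) F i s).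
Proof.
move=> FQ; elim: r => [|i r IH].
  by under eq_fun do rewrite big_nil; exact: smooth_series0.
have [Qi|Qi] := boolP (Q i).
  under eq_fun do rewrite big_cons Qi.
  by apply: smooth_seriesD; [exact: FQ | exact: IH].
by under eq_fun do rewrite big_cons (negbTE Qi).
Qed.

End smooth_series.

(** * Growth of the weights *)

Section weight_bounds.
Context {R : realType} (mu : weight_measure R).

Let D : set R := `]0, +oo[%classic.
Let f n := fun x : R => n%:R `^ (- (2 * x)) * wm_h mu x.

Let mD : measurable D.
Proof. exact: measurable_itv. Qed.

Let measurable_f n : (0 < n)%N -> measurable_fun D (fun x : R => (f n x)%:E).
Proof.
move=> n0; apply/measurable_EFinP; apply: measurable_funM => //.
  rewrite (_ : (fun x => _) = (fun x : R => expR (- (2 * x) * ln n%:R))).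
    apply: measurableT_comp => //; apply: measurable_funM => //.
    apply: measurableT_comp => //; exact: measurable_funM.
  by apply/funext => x; rewrite /powR gt_eqF// ltr0n.
exact: wm_h_measurable.
Qed.

Let f_ge0 n x : D x -> 0 <= f n x.
Proof. by rewrite /D/= in_itv/= andbT => x0; rewrite mulr_ge0 ?powR_ge0// wm_h_ge0. Qed.

Let int_f_le1 n : (0 < n)%N -> ((\int[lebesgue_measure]_(x in D) (f n x)%:E) <= 1)%E.
Proof.
move=> n0; rewrite -(wm_h_L1 mu); apply: ge0_le_integral => //.
- by move=> x Dx; rewrite lee_fin f_ge0.
- exact: measurable_f.
- by apply/measurable_EFinP; apply: measurableT_comp => //; exact: wm_h_measurable.
- move=> x; rewrite /D/= in_itv/= andbT => x0.
  rewrite lee_fin /f ger0_norm ?wm_h_ge0// ler_piMl ?wm_h_ge0//.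
  rewrite /powR gt_eqF ?ltr0n// -[leRHS]expR0 ler_expR mulNr oppr_le0.
  by apply: mulr_ge0; [exact: mulr_ge0 (ltW x0) | apply: ln_ge0; rewrite ler1n].
Qed.

Let int_f_fin n : (0 < n)%N ->
  (\int[lebesgue_measure]_(x in D) (f n x)%:E)%E \is a fin_num.
Proof.
move=> n0; rewrite ge0_fin_numE.
  by rewrite (le_lt_trans (int_f_le1 n0))// ltry.
by apply: integral_ge0 => x Dx; rewrite lee_fin f_ge0.
Qed.

Lemma weight_le1 n : (0 < n)%N -> weight mu n <= 1.
Proof.
by move=> n0; rewrite -lee_fin /weight /Rintegral fineK; [exact: int_f_le1|exact: int_f_fin].
Qed.

(** The measure charges [(0, e / 2)], where [n^(-2x) >= n^(-e)]. *)
Lemma weight_ge_powR (e : R) : 0 < e -> exists2 C : R, 0 < C &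
  forall n, (0 < n)%N -> C * n%:R `^ (- e) <= weight mu n.
Proof.
move=> e0; pose A : set R := `](- (e / 2)), (e / 2)[%classic.
have mA : measurable A by exact: measurable_itv.
have A0 : (0 < wm_mu mu A)%E.
  apply: (wm_supp0 mu); split; first exact: interval_open.
  by rewrite /A/= in_itv/= oppr_lt0 divr_gt0.
have Afin : wm_mu mu A \is a fin_num by exact: fin_num_measure.
exists (fine (wm_mu mu A)).
  by rewrite -lte_fin fineK.
move=> n n0; rewrite -lee_fin /weight /Rintegral fineK; last exact: int_f_fin.
rewrite EFinM fineK// (wm_density mu mA).
have mAD : measurable (A `&` D) := measurableI _ _ mA mD.
have hAD : measurable_fun (A `&` D) (fun x : R => (wm_h mu x)%:E).
  apply: (@measurable_funS _ _ _ _ D) => //.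
  by apply/measurable_EFinP; exact: wm_h_measurable.
rewrite -ge0_integralZr ?lee_fin ?powR_ge0//; last first.
  by move=> x [_]; rewrite /D/= in_itv/= andbT => x0; rewrite lee_fin wm_h_ge0.
apply: (@le_trans _ _ (\int[lebesgue_measure]_(x in A `&` D) (f n x)%:E)%E); last first.
  apply: ge0_subset_integral => //.
  - exact: measurable_f.
  - by move=> x Dx; rewrite lee_fin f_ge0.
apply: ge0_le_integral => //.
- move=> x [_]; rewrite /D/= in_itv/= andbT => x0.
  by rewrite -EFinM lee_fin mulr_ge0 ?powR_ge0 ?wm_h_ge0.
- apply: emeasurable_funM => //.
- apply: (@measurable_funS _ _ _ _ D) => //.
  exact: measurable_f.
move=> x []; rewrite /A /D/= !in_itv/= andbT => /andP[_ xe] x0.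
rewrite -EFinM lee_fin mulrC /f ler_wpM2r ?wm_h_ge0//.
by rewrite ler_powR ?ler1n//; lra.
Qed.

End weight_bounds.

(** * The norm of the partial kernel *)

Section cauchy_schwarz.
Context {R : realType}.

(** Stated with upper bounds [A], [B] for the norms, and proved through
    [2 x y <= (b / a) x^2 + (a / b) y^2] for all [a > A] and [b > B]. *)
Lemma sum_cauchy_schwarz (I : Type) (r : seq I) (Q : pred I) (x y : I -> R) (A B : R) :
  0 <= A -> 0 <= B ->
  \sum_(i <- r | Q i) x i ^+ 2 <= A ^+ 2 ->
  \sum_(i <- r | Q i) y i ^+ 2 <= B ^+ 2 ->
  \sum_(i <- r | Q i) x i * y i <= A * B.
Proof.
move=> A0 B0 xA yB.
have step a b : 0 < a -> 0 < b -> A <= a -> B <= b ->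
    \sum_(i <- r | Q i) x i * y i <= a * b.
  move=> a0 b0 Aa Bb.
  apply: (@le_trans _ _ (\sum_(i <- r | Q i)
      (b / a / 2 * x i ^+ 2 + a / b / 2 * y i ^+ 2))).
    apply: ler_sum => i _.
    rewrite -subr_ge0 (_ : _ - _ = (b * x i - a * y i) ^+ 2 / (2 * a * b)).
      by rewrite divr_ge0 ?sqr_ge0// ?mulr_ge0// ltW.
    by field; rewrite !gt_eqF.
  rewrite big_split/= -!mulr_sumr.
  have xa : \sum_(i <- r | Q i) x i ^+ 2 <= a ^+ 2.
    by apply: le_trans xA _; rewrite ler_pXn2r ?nnegrE ?(ltW a0).
  have yb : \sum_(i <- r | Q i) y i ^+ 2 <= b ^+ 2.
    by apply: le_trans yB _; rewrite ler_pXn2r ?nnegrE ?(ltW b0).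
  apply: (@le_trans _ _ (b / a / 2 * a ^+ 2 + a / b / 2 * b ^+ 2)).
    by apply: lerD; apply: ler_wpM2l => //; apply: divr_ge0 => //; apply: divr_ge0; exact: ltW.
  rewrite le_eqVlt; apply/orP; left; apply/eqP.
  by field; rewrite !gt_eqF.
apply/ler_addgt0Pl => e e0.
pose d := Num.min 1 (e / (A + B + 1)).
(* With [d <= 1], [(A + d) (B + d) <= A B + d (A + B + 1)]. *)
have AB0 : 0 < A + B + 1 by lra.
have d0 : 0 < d by rewrite lt_min ltr01 divr_gt0.
have d1 : d <= 1 by rewrite ge_min lexx.
have de : d * (A + B + 1) <= e by rewrite -ler_pdivlMr// ge_min lexx orbT.
apply: (le_trans (step (A + d) (B + d) _ _ _ _)); try lra.
nra.
Qed.

End cauchy_schwarz.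

Section kernel_sums.
Context {R : realType} (mu : weight_measure R) (P : nat).
Implicit Types (x : R).

Definition kernel_sum x N : R :=
  \sum_(1 <= n < N | (max_pdiv n <= P)%N) n%:R `^ (- (2 * x)) / weight mu n.

(** The norm of the partial kernel at any point of real part [x]. *)
Definition kernel_norm x : R := Num.sqrt (sup (range (kernel_sum x))).

Lemma kernel_term_ge0 x n : 0 <= n%:R `^ (- (2 * x)) / weight mu n.
Proof. by rewrite divr_ge0 ?powR_ge0 ?weight_ge0. Qed.

Lemma kernel_sum_mono x N M : (N <= M)%N -> kernel_sum x N <= kernel_sum x M.
Proof.
by apply: nondecreasing_series => n _ _; exact: kernel_term_ge0.
Qed.

Lemma kernel_sum_bounded x : 0 < x -> exists B : R, forall N, kernel_sum x N <= B.
Proof.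
move=> x0; have [C C0 hC] := weight_ge_powR mu x0.
have [B hB] := smooth_sum_bounded P x0.
exists (C^-1 * B) => N; apply: (@le_trans _ _ (C^-1 * \sum_(1 <= n < N | (max_pdiv n <= P)%N) n%:R `^ (- x))).
  rewrite mulr_sumr /kernel_sum big_nat_cond [leRHS]big_nat_cond.
  apply: ler_sum => n /andP[/andP[n0 _] _].
  rewrite (_ : - (2 * x) = - x + - x); last by ring.
  rewrite powRD; last by rewrite pnatr_eq0 gtn_eqF ?implybT.
  rewrite -mulrA mulrC ler_wpM2r ?powR_ge0//.
  by rewrite ler_pdivrMr ?weight_gt0// ler_pdivlMl// hC.
by rewrite ler_wpM2l// invr_ge0 ltW.
Qed.

Lemma kernel_norm_ge0 x : 0 <= kernel_norm x.
Proof. exact: sqrtr_ge0. Qed.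

Let has_sup_kernel_sum x : 0 < x -> has_sup (range (kernel_sum x)).
Proof.
move=> x0; split; first by exists (kernel_sum x 0), 0%N.
by have [B hB] := kernel_sum_bounded x0; exists B => _ [N _ <-].
Qed.

Lemma kernel_sum_le x N : 0 < x -> kernel_sum x N <= kernel_norm x ^+ 2.
Proof.
move=> x0; have h M : kernel_sum x M <= sup (range (kernel_sum x)).
  by apply: ub_le_sup; [exact: (has_sup_kernel_sum x0).2 | exists M].
rewrite /kernel_norm sqr_sqrtr//; apply: le_trans (h 0%N).
by rewrite /kernel_sum big_geq.
Qed.

Lemma kernel_norm_le x (B : R) : 0 < x -> 0 <= B ->
  (forall N, kernel_sum x N <= B ^+ 2) -> kernel_norm x <= B.
Proof.
move=> x0 B0 hB; rewrite -[leRHS](ger0_norm B0) -sqrtr_sqr ler_wsqrtr//.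
by apply: ge_sup => [|_ [N _ <-]//]; exact: (has_sup_kernel_sum x0).1.
Qed.

(** The weights being at most [1], each of the powers [1, 2, ..., 2 ^ A.-1]
    contributes at least [1/2] to the squared norm once [x] is small enough. *)
Lemma kernel_norm_cvg_pinfty (H : R) : (2 <= P)%N ->
  \forall x \near 0^'+, H <= kernel_norm x.
Proof.
move=> P2.
have [A HA] : exists A : nat, H ^+ 2 *+ 2 <= A%:R.
  by exists (Num.truncn (H ^+ 2 *+ 2)).+1; rewrite ltW// truncnS_gt.
(* For [x <= d] and [k <= A], [2 x log (2 ^ k) <= 2 d 2 ^ A = 1/2]. *)
pose d : R := (4 * 2 ^ A)%:R^-1.
have d0 : 0 < d by rewrite invr_gt0 ltr0n muln_gt0 expn_gt0.
near=> x.
have x0 : 0 < x by near: x; exact: nbhs_right_gt.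
have xd : x <= d by near: x; exact: nbhs_right_le.
have pow2 k : (max_pdiv (2 ^ k) <= P)%N.
  apply: leq_trans P2; have [k0|k1] := leqP (2 ^ k) 1.
    by rewrite (leq_trans (max_pdiv_leq _)) ?expn_gt0// (leq_trans k0).
  have pr := max_pdiv_prime k1; apply: dvdn_leq => //.
  have := max_pdiv_dvd (2 ^ k); rewrite Euclid_dvdX// => /andP[]//.
have low k : (k <= A)%N -> k%:R / 2 <= kernel_sum x (2 ^ k).
  elim: k => [|k IH] kA; first by rewrite mul0r /kernel_sum big_geq.
  rewrite /kernel_sum (@big_cat_nat _ _ _ (2 ^ k))//=; last 2 first.
  - by rewrite expn_gt0.
  - by rewrite leq_exp2l.
  rewrite -natr1 mulrDl lerD ?IH 1?ltnW//.
  rewrite big_mkcond big_ltn ?ltn_exp2l// pow2.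
  rewrite -[leLHS]addr0 lerD//; last first.
    by apply: sumr_ge0 => n _; case: ifP => // _; exact: kernel_term_ge0.
  have k2 : (0 < 2 ^ k)%N by rewrite expn_gt0.
  rewrite ler_pdivlMr ?weight_gt0//.
  apply: (@le_trans _ _ (1 / 2)); first by rewrite ler_piMr// weight_le1.
  have kR : (0 : R) < (2 ^ k)%:R by rewrite ltr0n.
  rewrite /powR gt_eqF//; apply: le_trans (expR_ge1Dx _).
  suff : 2 * x * ln (2 ^ k)%:R <= 1 / 2 :> R by rewrite mulNr; lra.
  apply: (@le_trans _ _ (2 * d * (2 ^ A)%:R)).
    apply: ler_pM => //.
    - by rewrite mulr_ge0// ltW.
    - by rewrite ln_ge0// ler1n.
    - by rewrite ler_pM2l.
    - by rewrite (le_trans (ltW (ln_sublinear kR)))// ler_nat leq_exp2l// ltnW.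
  have A0 : ((2 ^ A)%:R : R) != 0 by rewrite pnatr_eq0 -lt0n expn_gt0.
  rewrite /d natrM le_eqVlt; apply/orP; left; apply/eqP.
  by field; rewrite A0.
have := le_trans (low A (leqnn A)) (kernel_sum_le _ x0).
rewrite leNgt => hA; rewrite leNgt; apply/negP => kH.
move/negP: hA; apply; apply: (@lt_le_trans _ _ (H ^+ 2)); last first.
  by rewrite ler_pdivlMr// mulr_natr.
have k0 := kernel_norm_ge0 x.
by rewrite ltr_pXn2r// nnegrE// ltW// (le_lt_trans k0).
Unshelve. all: by end_near. Qed.

End kernel_sums.

(** * Absolute convergence and coefficients in the space *)

Lemma natpow_conj_sub (R : realType) n (z : R[i]) : (0 < n)%N ->
  natpow n (- z^*%C - z) = (n%:R `^ (- (2 * complex.Re z)))%:C.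
Proof.
move=> n0; rewrite (_ : - z^*%C - z = (- (2 * complex.Re z))%:C); last first.
  by case: z => x y; apply/eqP; rewrite eq_complex/=; apply/andP; split; apply/eqP; ring.
rewrite /natpow/= mul0r cos0 sin0 mulr1 mulr0 complexr0.
by rewrite /powR gt_eqF// ltr0n.
Qed.

Section abs_conv_theory.
Context {R : realType}.
Implicit Types (a b : nat -> R[i]) (s : R[i]).

Lemma abs_conv_cvg b s : abs_conv b s ->
  dirichlet_sum b ^~ s @ \oo --> dirichlet_series b s.
Proof.
move=> [B bB]; have [z bz] := abs_sum_cvg bB.
rewrite /dirichlet_series (seq_lim (u := dirichlet_sum b ^~ s) (z := z))//.
Qed.

Lemma dirichlet_seriesD a b s : abs_conv a s -> abs_conv b s ->
  dirichlet_series (fun n => a n + b n) s = dirichlet_series a s + dirichlet_series b s.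
Proof.
move=> /abs_conv_cvg aa /abs_conv_cvg bb; apply: seq_lim.
rewrite (_ : dirichlet_sum _ ^~ s = fun N => dirichlet_sum a N s + dirichlet_sum b N s).
  exact: seq_cvgD aa bb.
by apply/funext => N; rewrite /dirichlet_sum -big_split/=; apply: eq_bigr => m _; rewrite mulrDl.
Qed.

Lemma normc_dirichlet_series_le b s (B : R) :
  (forall N, \sum_(1 <= m < N) normc (b m * natpow m (- s)) <= B) ->
  normc (dirichlet_series b s) <= B.
Proof.
move=> bB; have bc : abs_conv b s by exists B.
apply: (normc_lim_le (abs_conv_cvg bc)); exists 0%N => // N _ /=.
exact: le_trans (normc_sum _ _ _) (bB N).
Qed.

Lemma sum_inv_sqr N : \sum_(1 <= n < N) (n%:R : R) `^ (-2) <= 2.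
Proof.
suff h k : \sum_(1 <= n < k.+2) (n%:R : R) `^ (-2) <= 2 - k.+1%:R^-1.
  case: N => [|[|k]]; try by rewrite big_geq.
  by apply: le_trans (h k) _; rewrite lerBlDr lerDl invr_ge0.
have e n : (n%:R : R) `^ (-2) = (n%:R ^+ 2)^-1.
  by rewrite powRN -[2%R]/(2%:R) powR_mulrn.
elim: k => [|k IH]; first by rewrite big_nat1 powR1 invr1; lra.
rewrite big_nat_recr//= e; apply: le_trans (lerD IH (lexx _)) _.
have a0 : (0 : R) < k.+1%:R by rewrite ltr0n.
rewrite -[k.+2%:R]natr1; move: (k.+1%:R : R) a0 => a a0.
rewrite -subr_ge0 (_ : _ - _ = (a * (a + 1) ^+ 2)^-1).
  by rewrite invr_ge0 mulr_ge0 ?sqr_ge0// ltW.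
by field; rewrite !gt_eqF//; lra.
Qed.

End abs_conv_theory.

Section A2_theory.
Context {R : realType} (mu : weight_measure R).
Implicit Types (f g : A2 mu) (a : nat -> R[i]) (s : R[i]).

Definition A2_rnorm f : R := Num.sqrt (fine (A2_sqnorm mu f)).

Lemma A2_normE f : `|f| = (A2_rnorm f)%:C.
Proof. by []. Qed.

Lemma A2_rnorm_ge0 f : 0 <= A2_rnorm f.
Proof. exact: sqrtr_ge0. Qed.

Lemma A2_sum_le f (Q : pred nat) N :
  \sum_(1 <= n < N | Q n) normc (f n) ^+ 2 * weight mu n <= A2_rnorm f ^+ 2.
Proof.
rewrite -lee_fin /A2_rnorm -A2_sqnorm_fine.
apply: (@le_trans _ _ (\sum_(1 <= n < N) (normc (f n) ^+ 2 * weight mu n)%:E)%E).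
  rewrite sumEFin lee_fin big_mkcond; apply: ler_sum => n _.
  by case: ifP => // _; rewrite mulr_ge0 ?sqr_ge0 ?weight_ge0.
by apply: (@nneseries_lim_ge _ _ xpredT _ N) => k _ _; exact: A2_term_ge0.
Qed.

Lemma A2_exists a (B : R) : 0 <= B -> a 0%N = 0 ->
  (forall N, \sum_(1 <= n < N) normc (a n) ^+ 2 * weight mu n <= B ^+ 2) ->
  exists2 f : A2 mu, A2_coef f = a & A2_rnorm f <= B.
Proof.
move=> B0 a0 aB.
have le : (A2_sqnorm mu a <= (B ^+ 2)%:E)%E.
  apply: lime_le; first by apply: is_cvg_nneseries => n _ _; exact: A2_term_ge0.
  by apply: nearW => N; rewrite sumEFin lee_fin.
have ha : a \in A2_pred mu.
  by apply/asboolP; split => //; rewrite (le_lt_trans le)// ltry.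
exists (MkA2 ha) => //.
rewrite /A2_rnorm -[leRHS](ger0_norm B0) -sqrtr_sqr ler_wsqrtr//.
by rewrite -lee_fin fineK//; exact: (A2_sqnorm_fin (MkA2 ha)).
Qed.

(** Cauchy-Schwarz for [a n * sqrt (w n)] and [n^(-x) / sqrt (w n)], on any
    interval of indices so that it applies to tails as well. *)
Lemma A2_kernel_cs a (Q : pred nat) m N (x A B : R) : (0 < m)%N ->
  0 <= A -> 0 <= B ->
  \sum_(m <= n < N | Q n) normc (a n) ^+ 2 * weight mu n <= A ^+ 2 ->
  \sum_(m <= n < N | Q n) n%:R `^ (- (2 * x)) / weight mu n <= B ^+ 2 ->
  \sum_(m <= n < N | Q n) normc (a n) * n%:R `^ (- x) <= A * B.
Proof.
move=> m0 A0 B0 hA hB.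
rewrite (_ : \sum_(_ <= _ < _ | _) _ = \sum_(m <= n < N | Q n)
   (normc (a n) * Num.sqrt (weight mu n)) * (n%:R `^ (- x) / Num.sqrt (weight mu n))).
  apply: sum_cauchy_schwarz => //.
    apply: le_trans hA; apply: ler_sum => n _.
    by rewrite exprMn sqr_sqrtr// weight_ge0.
  apply: le_trans hB; rewrite big_nat_cond [leRHS]big_nat_cond.
  apply: ler_sum => n /andP[/andP[mn _] _].
  rewrite exprMn exprVn sqr_sqrtr ?weight_ge0// (_ : - (2 * x) = - x + - x); last by ring.
  by rewrite powRD ?expr2// pnatr_eq0 gtn_eqF ?implybT// (leq_trans m0 mn).
rewrite big_nat_cond [RHS]big_nat_cond.
apply: eq_bigr => n /andP[/andP[mn _] _].
have w0 : 0 < Num.sqrt (weight mu n) by rewrite sqrtr_gt0 weight_gt0// (leq_trans m0).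
by field; rewrite gt_eqF.
Qed.

Lemma Re_opp s : complex.Re (- s) = - complex.Re s.
Proof. by case: s. Qed.

Lemma A2_abs_conv f s : 2 <= complex.Re s -> abs_conv f s.
Proof.
move=> s2; have [C C0 hC] := weight_ge_powR mu (ltr0n R 2).
exists (A2_rnorm f * Num.sqrt (C^-1 * 2)) => N.
apply: (@le_trans _ _ (\sum_(1 <= n < N) normc (f n) * n%:R `^ (- 2))).
  rewrite big_nat [leRHS]big_nat; apply: ler_sum => n /andP[n0 _].
  rewrite normcM normc_natpow// ler_wpM2l ?normc_ge0// Re_opp.
  by rewrite ler_powR ?ler1n// lerN2.
apply: A2_kernel_cs => //; rewrite ?sqrtr_ge0//; first exact: A2_sum_le.
have C2 : 0 <= C^-1 * 2 by rewrite mulr_ge0// invr_ge0 ltW.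
rewrite sqr_sqrtr//.
apply: (@le_trans _ _ (C^-1 * \sum_(1 <= n < N) (n%:R : R) `^ (-2))); last first.
  by rewrite ler_wpM2l ?sum_inv_sqr// invr_ge0 ltW.
rewrite mulr_sumr big_nat [leRHS]big_nat; apply: ler_sum => n /andP[n0 _].
rewrite (_ : - (2 * 2) = -2 + -2 :> R); last by ring.
rewrite powRD; last by rewrite pnatr_eq0 gtn_eqF ?implybT.
rewrite -mulrA mulrC ler_wpM2r ?powR_ge0//.
by rewrite ler_pdivrMr ?weight_gt0// ler_pdivlMl// hC.
Qed.

Lemma half_plane_int_ge2 k : half_plane (2^-1 : R) (2 + k%:R).
Proof.
rewrite /half_plane/= -[2 + _]natrD -[X in _ < complex.Re X](rmorph_nat (real_complex R))/=.
by rewrite (@lt_le_trans _ _ 1)// ?invf_lt1 ?ltr1n// ler1n.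
Qed.

Lemma Re_int_ge2 k : 2 <= complex.Re (2 + k%:R : R[i]).
Proof.
by rewrite -[2 + _]natrD -[X in _ <= complex.Re X](rmorph_nat (real_complex R))/= ler_nat leq_addr.
Qed.

(** In the main estimate [a] are the coefficients of [f o Phi], whose membership
    in the space is what the equality shows. *)
Lemma A2_coef_unique a f : abs_conv a 2 ->
  (forall k, dirichlet_sum a ^~ (2 + k%:R) @ \oo --> dirichlet_series f (2 + k%:R)) ->
  forall n, (0 < n)%N -> a n = f n.
Proof.
move=> aa af n n0; apply/eqP; rewrite -subr_eq0; apply/eqP.
apply: (@dirichlet_unique _ (fun n => a n - f n)); last exact: n0.
  have [B fB] : abs_conv f 2 by apply: A2_abs_conv; have := Re_int_ge2 0; rewrite addr0.
  have [A aA] := aa; exists (A + B) => N; apply: le_trans (lerD (aA N) (fB N)).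
  rewrite -big_split/=; apply: ler_sum => m _.
  by rewrite mulrBl; apply: le_trans (normcD _ _) _; rewrite normcN.
move=> k; rewrite (_ : dirichlet_sum _ ^~ _ =
    fun N => dirichlet_sum a N (2 + k%:R) - dirichlet_sum f N (2 + k%:R)).
  rewrite -(subrr (dirichlet_series f (2 + k%:R))); apply: seq_cvgB; first exact: af.
  by apply: abs_conv_cvg; apply: A2_abs_conv; exact: Re_int_ge2.
by apply/funext => N; rewrite /dirichlet_sum -sumrB; apply: eq_bigr => m _; rewrite mulrBl.
Qed.

End A2_theory.

(** * Evaluation of smooth parts near the imaginary axis *)

Section smooth_part.
Context {R : realType} (mu : weight_measure R) (P : nat).
Implicit Types (f g : A2 mu) (a : nat -> R[i]) (s z : R[i]).

Definition smooth_part a (n : nat) : R[i] :=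
  if (0 < n)%N && (max_pdiv n <= P)%N then a n else 0.

Lemma sum_smooth_part a s m N : (0 < m)%N ->
  \sum_(m <= n < N) normc (smooth_part a n * natpow n (- s)) =
  \sum_(m <= n < N | (max_pdiv n <= P)%N) normc (a n) * n%:R `^ (- complex.Re s).
Proof.
move=> m0; rewrite [RHS]big_mkcond/= [LHS]big_nat [RHS]big_nat.
apply: eq_bigr => n /andP[mn _]; have n0 := leq_trans m0 mn.
rewrite /smooth_part n0/=; case: ifP => _; last by rewrite mul0r normc0.
by rewrite normcM normc_natpow// Re_opp.
Qed.

Lemma kernel_sum_sub_le m N (x : R) : (0 < m)%N -> 0 < x ->
  \sum_(m <= n < N | (max_pdiv n <= P)%N) n%:R `^ (- (2 * x)) / weight mu n <=
  kernel_norm mu P x ^+ 2.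
Proof.
move=> m0 x0; apply: le_trans (kernel_sum_le mu P N x0).
rewrite /kernel_sum; have [mN|Nm] := leqP m N; last first.
  by rewrite big_geq ?(ltnW Nm)// sumr_ge0// => n _; exact: kernel_term_ge0.
rewrite [leRHS](@big_cat_nat _ _ _ m)//= lerDr sumr_ge0// => n _.
exact: kernel_term_ge0.
Qed.

Lemma sum_smooth_part_le f s N : 0 < complex.Re s ->
  \sum_(1 <= n < N) normc (smooth_part f n * natpow n (- s)) <=
  A2_rnorm f * kernel_norm mu P (complex.Re s).
Proof.
move=> s0; rewrite sum_smooth_part//.
apply: (A2_kernel_cs (mu := mu)); rewrite ?A2_rnorm_ge0 ?kernel_norm_ge0//.
  exact: A2_sum_le.
exact: kernel_sum_sub_le.
Qed.

Lemma smooth_part_abs_conv f s : 0 < complex.Re s -> abs_conv (smooth_part f) s.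
Proof.
by move=> s0; exists (A2_rnorm f * kernel_norm mu P (complex.Re s)) => N; exact: sum_smooth_part_le.
Qed.

Lemma smooth_part_eval_le f s : 0 < complex.Re s ->
  normc (dirichlet_series (smooth_part f) s) <=
  A2_rnorm f * kernel_norm mu P (complex.Re s).
Proof.
by move=> s0; apply: normc_dirichlet_series_le => N; exact: sum_smooth_part_le.
Qed.

Lemma smooth_part_evalD f g s : 0 < complex.Re s ->
  dirichlet_series (smooth_part (f + g)) s =
  dirichlet_series (smooth_part f) s + dirichlet_series (smooth_part g) s.
Proof.
move=> s0; rewrite -dirichlet_seriesD; last 2 first.
- exact: smooth_part_abs_conv.
- exact: smooth_part_abs_conv.
congr dirichlet_series; apply/funext => n; rewrite /smooth_part.
by case: ifP; rewrite ?addr0.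
Qed.

(** An initial segment of the series stays bounded while the kernel norm blows
    up, and the tail has small norm. *)
Lemma smooth_part_eval_small f (e : R) : (2 <= P)%N -> 0 < e ->
  \forall x \near 0^'+, forall s, complex.Re s = x ->
    normc (dirichlet_series (smooth_part f) s) <= e * kernel_norm mu P x.
Proof.
move=> P2 e0.
have e2 : 0 < e / 2 by rewrite divr_gt0.
pose M n := normc (f n) ^+ 2 * weight mu n.
have M0 k : 0 <= M k by rewrite mulr_ge0 ?sqr_ge0 ?weight_ge0.
have [A A1 hA] := small_tail M0 (A2_sum_le f xpredT) (exprn_gt0 2 e2).
pose H := \sum_(1 <= n < A) normc (f n).
have H0 : 0 <= H by apply: sumr_ge0 => n _; exact: normc_ge0.
near=> x => s sx.
have x0 : 0 < x by near: x; exact: nbhs_right_gt.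
have kH : H / (e / 2) <= kernel_norm mu P x.
  by near: x; exact: kernel_norm_cvg_pinfty.
apply: normc_dirichlet_series_le => N.
apply: (@le_trans _ _ (H + e / 2 * kernel_norm mu P x)); last first.
  by move: kH; rewrite ler_pdivrMr//; lra.
have tail : \sum_(A <= n < N) normc (smooth_part f n * natpow n (- s)) <=
    e / 2 * kernel_norm mu P x.
  rewrite sum_smooth_part// sx.
  apply: (A2_kernel_cs (mu := mu)); rewrite ?(ltW e2) ?kernel_norm_ge0//.
    apply: le_trans (hA N); rewrite big_mkcond; apply: ler_sum => n _.
    by case: ifP => // _; exact: M0.
  exact: kernel_sum_sub_le.
have head m : \sum_(1 <= n < m) normc (smooth_part f n * natpow n (- s)) <=
    \sum_(1 <= n < m) normc (f n).
  rewrite big_nat [leRHS]big_nat; apply: ler_sum => n /andP[n0 _].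
  rewrite /smooth_part; case: ifP => _; last by rewrite mul0r normc0 normc_ge0.
  rewrite normcM normc_natpow// Re_opp sx ler_piMr ?normc_ge0//.
  by rewrite -[leRHS](powRr0 (n%:R : R)) ler_powR ?ler1n// lerNl oppr0 ltW.
have [AN|NA] := leqP A N.
  by rewrite (@big_cat_nat _ _ _ A)//= lerD.
apply: (le_trans (head N)); rewrite -[leLHS]addr0 lerD//.
  have [N1|N1] := leqP N 1; first by rewrite big_geq.
  rewrite /H [leRHS](@big_cat_nat _ _ _ N)//= ?(ltnW N1) ?(ltnW NA)// lerDl.
  by apply: sumr_ge0 => n _; exact: normc_ge0.
by rewrite mulr_ge0 ?(ltW e2) ?kernel_norm_ge0.
Unshelve. all: by end_near. Qed.

(** The evaluations divided by the kernel norm have operator norm at most [1] and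
    tend to [0] at each element; such a family tends to [0] uniformly on compact
    sets, here the closure of the image of the unit ball. *)
Lemma compact_smooth_part_eval_small (K : {linear A2 mu -> A2 mu}) (e : R) :
  (2 <= P)%N -> compact_operator K -> 0 < e ->
  \forall x \near 0^'+, forall f, A2_rnorm f <= 1 -> forall s, complex.Re s = x ->
    normc (dirichlet_series (smooth_part (K f)) s) <= e * kernel_norm mu P x.
Proof.
move=> P2 Kc e0.
have e2 : 0 < e / 2 by rewrite divr_gt0.
pose Q (x : R) (h : A2 mu) := forall s, complex.Re s = x ->
  normc (dirichlet_series (smooth_part h) s) <= e * kernel_norm mu P x.
have cov x0 : closure (K @` [set f : A2 mu | `|f| <= 1]) x0 ->
    \forall x' \near x0 & x \near (0 : R)^'+, Q x x'.
  move=> _; exists ([set h | `|x0 - h| < (e / 2)%:C],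
      [set x : R | 0 < x /\ forall s, complex.Re s = x ->
        normc (dirichlet_series (smooth_part x0) s) <= e / 2 * kernel_norm mu P x]).
    split=> /=.
      by apply/nbhs_ballP; exists (e / 2)%:C => /=; rewrite ?ltcR// -ball_normE.
    near=> x; split; first by near: x; exact: nbhs_right_gt.
    by near: x; exact: smooth_part_eval_small.
  move=> [h x] /= [hx [xpos xs]] s sx.
  have s0 : 0 < complex.Re s by rewrite sx.
  have -> : dirichlet_series (smooth_part h) s = dirichlet_series (smooth_part (h - x0)) s +
      dirichlet_series (smooth_part x0) s by rewrite -smooth_part_evalD// subrK.
  apply: le_trans (normcD _ _) _; rewrite [e]splitr mulrDl lerD ?xs//.
  apply: (le_trans (smooth_part_eval_le _ s0)); rewrite sx.
  rewrite ler_wpM2r ?kernel_norm_ge0// ltW//.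
  by move: hx; rewrite distrC A2_normE ltcR.
have near_Q : \forall x \near (0 : R)^'+, closure (K @` [set f : A2 mu | `|f| <= 1]) `<=` Q x.
  by apply: ((compact_near_coveringP _).1 Kc); exact: cov.
apply: filterS near_Q => x hx f f1 s sx; apply: (hx (K f) _ s sx).
by apply: subset_closure; exists f => //=; rewrite A2_normE lecR.
Unshelve. all: by end_near. Qed.

End smooth_part.

(** * The partial kernel as an element of the space *)

Lemma nth_prime_ge l : (l <= nth_prime l)%N.
Proof.
elim: l => // l IH; rewrite /nth_prime iterS -/(nth_prime l).
by case: ex_minnP => p /andP[lp _] _; exact: leq_ltn_trans lp.
Qed.

Lemma nth_prime_ge2 l : (1 <= l)%N -> (2 <= nth_prime l)%N.
Proof.
case: l => // l _; rewrite /nth_prime iterS.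
by case: ex_minnP => p /andP[_ pp] _; exact: prime_gt1.
Qed.

Section partial_kernel_norm.
Context {R : realType} (mu : weight_measure R).
Implicit Types (f g : A2 mu) (z s : R[i]).

Definition kernel_coef P z (n : nat) : R[i] :=
  smooth_part P (fun n => natpow n (- z^*%C) / (weight mu n)%:C) n.

Lemma kernel_coef_sqr P z n : (0 < n)%N ->
  normc (kernel_coef P z n) ^+ 2 * weight mu n =
  if (max_pdiv n <= P)%N then n%:R `^ (- (2 * complex.Re z)) / weight mu n else 0.
Proof.
move=> n0; rewrite /kernel_coef /smooth_part n0/=; case: ifP => _; last first.
  by rewrite normc0 expr0n mul0r.
have w0 := weight_gt0 mu n0.
rewrite normcM normcV normc_real gtr0_norm// normc_natpow// Re_opp.
rewrite (_ : complex.Re z^*%C = complex.Re z); last by case: (z).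
rewrite (_ : - (2 * complex.Re z) = - complex.Re z + - complex.Re z); last by ring.
rewrite powRD; last by rewrite pnatr_eq0 gtn_eqF ?implybT.
by field; rewrite gt_eqF.
Qed.

Lemma sum_kernel_coef_sqr P z N :
  \sum_(1 <= n < N) normc (kernel_coef P z n) ^+ 2 * weight mu n =
  kernel_sum mu P (complex.Re z) N.
Proof.
rewrite /kernel_sum [RHS]big_mkcond/= [LHS]big_nat [RHS]big_nat.
by apply: eq_bigr => n /andP[n0 _]; exact: kernel_coef_sqr.
Qed.

Lemma partial_kernelE l z w : partial_kernel mu l z w =
  dirichlet_series (kernel_coef (nth_prime l) z) w.
Proof.
rewrite /partial_kernel /dirichlet_series; congr (limn _); apply/funext => N.
rewrite /dirichlet_sum big_mkcond big_nat [RHS]big_nat; apply: eq_bigr => n /andP[n0 _].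
rewrite /kernel_coef /smooth_part n0/=; case: ifP => _; last by rewrite mul0r.
by rewrite natpowD mulrAC.
Qed.

Lemma kernel_in_A2 P z : 0 < complex.Re z -> exists2 f : A2 mu,
  A2_coef f = kernel_coef P z & A2_rnorm f = kernel_norm mu P (complex.Re z).
Proof.
move=> z0.
have [||N|f fk fn] := @A2_exists _ mu (kernel_coef P z) (kernel_norm mu P (complex.Re z)).
- exact: kernel_norm_ge0.
- by rewrite /kernel_coef /smooth_part.
- by rewrite sum_kernel_coef_sqr; exact: kernel_sum_le.
exists f => //; apply/eqP; rewrite eq_le fn/=; apply: kernel_norm_le => //.
  exact: A2_rnorm_ge0.
by move=> N; rewrite -sum_kernel_coef_sqr -fk; exact: (A2_sum_le f xpredT).
Qed.

(** Only one element of the space represents the kernel, so the infimum in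
    [A2_fun_norm] is attained at its coefficients. *)
Lemma A2_fun_norm_partial_kernel l z : 0 < complex.Re z ->
  A2_fun_norm mu (partial_kernel mu l z) =
  (kernel_norm mu (nth_prime l) (complex.Re z))%:E.
Proof.
move=> z0; have [k kk kn] := kernel_in_A2 (nth_prime l) z0.
rewrite -kn; apply/eqP; rewrite eq_le; apply/andP; split.
  apply: ereal_inf_lbound; exists k => //= s _.
  by rewrite partial_kernelE kk.
apply: le_ereal_inf_tmp => _ [f /= fk <-].
suff -> : f = k by [].
apply/val_inj/funext => -[|n].
  by rewrite /=; have /asboolP[-> _] := valP f; have /asboolP[-> _] := valP k.
apply/esym; apply: (A2_coef_unique (mu := mu)) => //.
  by apply: A2_abs_conv; have := Re_int_ge2 (R := R) 0; rewrite addr0.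
move=> j; rewrite -fk ?partial_kernelE; last exact: half_plane_int_ge2.
by rewrite -kk; apply: abs_conv_cvg; apply: A2_abs_conv; exact: Re_int_ge2.
Qed.

End partial_kernel_norm.

(** * Composition with the symbol *)

Section symbol.
Context {R : realType} (c0 : nat) (c : nat -> R[i]) (Phi : R[i] -> R[i])
  (hPhi : is_symbol c0 c Phi).

Lemma symbol_cvg s : half_plane 0 s ->
  dirichlet_sum c ^~ s @ \oo --> Phi s - c0%:R * s.
Proof.
rewrite /half_plane/= => s0; have s2 : 0 < complex.Re s / 2 by rewrite divr_gt0.
have := symbol_uniform hPhi s2.
have sub : [set s] `<=` half_plane (complex.Re s / 2).
  by move=> _ ->; rewrite /half_plane/=; lra.
move=> /(uniform_subset_cvg _ sub); rewrite uniform_set1.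
exact.
Qed.

Lemma symbol_Re_gt0 s : half_plane 0 s -> half_plane 0 (Phi s).
Proof.
move=> s0; have := symbol_pos hPhi s0.
rewrite /half_plane/= -[c0%:R](rmorph_nat (real_complex R)).
move: s0; rewrite /half_plane/=; case: s => x y /=; case: (Phi _) => u v /=.
rewrite mul0r subr0 subr_gt0 => x0 h; apply: le_lt_trans h.
by rewrite mulr_ge0// ltW.
Qed.

(** [n^(- Phi s)] is [(n^c0)^(- s)] times the exponential of a multiple of
    [Phi s - c0 s], which is a smooth series. *)
Lemma smooth_series_natpow_symbol P n :
  (forall m, (0 < m)%N -> (P < max_pdiv m)%N -> c m = 0) ->
  (0 < n)%N -> (max_pdiv n <= P)%N -> smooth_series P (fun s => natpow n (- Phi s)).
Proof.
move=> cP n0 nP.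
have P0 : (0 < P)%N := leq_trans (max_pdiv_gt0 n) nP.
have -> : (fun s => natpow n (- Phi s)) = fun s =>
    natpow (n ^ c0) (- s) * cexp ((Phi s - c0%:R * s) * (- (ln n%:R)%:C)).
  apply/funext => s; rewrite natpow_expn// [_ * - (ln _)%:C]mulrN -mulNr -natpowE -natpowD.
  by congr natpow; ring.
apply: smooth_seriesM.
  apply: smooth_series_natpow; first by rewrite expn_gt0 n0.
  elim: c0 => [|k IH]; first by rewrite expn0.
  by rewrite expnS max_pdivM// expn_gt0 n0.
apply: smooth_series_exp => //; apply: smooth_seriesM; last exact: smooth_series_cst.
apply: (smooth_series_of_cvg cP) => s s0; exact: symbol_cvg.
Qed.

End symbol.

(** * The lower bound for the essential norm *)

Section essential_norm.
Context {R : realType} (mu : weight_measure R) (P c0 : nat) (c : nat -> R[i])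
  (Phi : R[i] -> R[i]) (hPhi : is_symbol c0 c Phi)
  (cP : forall m, (0 < m)%N -> (P < max_pdiv m)%N -> c m = 0).

Lemma finite_dirichlet_series (a : nat -> R[i]) N w :
  (forall n, (N <= n)%N -> a n = 0) -> dirichlet_series a w = dirichlet_sum a N w.
Proof.
move=> aN; apply: seq_lim; apply/complex_cvgP => e e0; exists N.+1 => // M /= NM.
suff -> : dirichlet_sum a M w = dirichlet_sum a N w by rewrite subrr normc0 ltW.
rewrite /dirichlet_sum; case: N aN NM => [|N] aN NM.
  by rewrite [RHS]big_geq// big1// => n _; rewrite aN// mul0r.
rewrite (@big_cat_nat _ _ _ N.+1)//=; last exact: ltnW.
rewrite [X in _ + X](_ : _ = 0) ?addr0// big_nat big1// => n /andP[Nn _].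
by rewrite aN// mul0r.
Qed.

(** The element [f] realising the bound is the kernel at [Phi s], cut off at [N]
    and normalised: its value at [Phi s] is the square root [r] of the cut-off
    squared norm, and [f o Phi - K f] is represented by an element [g] of norm
    at most [M]. *)
Lemma kernel_norm_symbol_le (K : A2 mu -> A2 mu) (M e : R) s :
  half_plane 0 s ->
  (forall f : A2 mu, A2_rnorm f <= 1 -> exists2 g : A2 mu, A2_rnorm g <= M &
    forall w, half_plane 2^-1 w ->
      dirichlet_series f (Phi w) - dirichlet_series (K f) w = dirichlet_series g w) ->
  (forall f : A2 mu, A2_rnorm f <= 1 ->
    normc (dirichlet_series (smooth_part P (K f)) s) <=
    e * kernel_norm mu P (complex.Re s)) ->
  kernel_norm mu P (complex.Re (Phi s)) <= (M + e) * kernel_norm mu P (complex.Re s).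
Proof.
move=> s0 hM hK; set z := Phi s.
have z0 : 0 < complex.Re z by exact: (symbol_Re_gt0 hPhi s0).
have rnorm0 : A2_rnorm (0 : A2 mu) <= 1.
  by have := normr0 (A2 mu); rewrite A2_normE => /complexI ->.
have M0 : 0 <= M by have [g gM _] := hM 0 rnorm0; exact: le_trans (A2_rnorm_ge0 g) gM.
have B0 : 0 <= (M + e) * kernel_norm mu P (complex.Re s).
  rewrite mulrDl addr_ge0//; first by rewrite mulr_ge0 ?kernel_norm_ge0.
  exact: le_trans (normc_ge0 _) (hK 0 rnorm0).
apply: kernel_norm_le => // N.
set S := kernel_sum mu P _ N.
have [S0|S0] := leP S 0; first by rewrite (le_trans S0)// sqr_ge0.
pose r := Num.sqrt S.
have r0 : 0 < r by rewrite sqrtr_gt0.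
have rS : r ^+ 2 = S by rewrite sqr_sqrtr// ltW.
pose a n := if (n < N)%N then (r^-1)%:C * kernel_coef mu P z n else 0.
have [|m|f fa f1] := @A2_exists _ mu a 1 ler01.
- by rewrite /a /kernel_coef /smooth_part/= mulr0; case: ifP.
- rewrite expr1n (_ : \sum_(_ <= _ < _) _ = r^-1 ^+ 2 * kernel_sum mu P (complex.Re z) (minn m N)).
    apply: (@le_trans _ _ (r^-1 ^+ 2 * S)).
      by rewrite ler_wpM2l ?sqr_ge0// kernel_sum_mono// geq_minr.
    by rewrite -rS -exprMn mulVf ?gt_eqF// expr1n.
  rewrite -sum_kernel_coef_sqr (big_nat_widen _ _ _ _ _ (geq_minl m N)).
  rewrite [in RHS]big_mkcond/= mulr_sumr [LHS]big_nat [RHS]big_nat.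
  apply: eq_bigr => n /andP[_ nm]; rewrite leq_min nm/= /a; case: ifP => _.
    by rewrite normcM normc_real gtr0_norm ?invr_gt0// exprMn -mulrA.
  by rewrite normc0 expr0n mul0r mulr0.
pose F w := \sum_(1 <= n < N) a n * natpow n (- Phi w).
have fF w : dirichlet_series f (Phi w) = F w.
  rewrite fa (@finite_dirichlet_series a N)//.
  by move=> n Nn; rewrite /a ltnNge Nn.
have [b b0 bF] : smooth_series P F.
  apply: smooth_series_sum => n _.
  have [/andP[n0 nP]|nS] := boolP ((0 < n)%N && (max_pdiv n <= P)%N).
    apply: smooth_seriesM; last exact: (smooth_series_natpow_symbol hPhi cP n0 nP).
    by apply: smooth_series_cst; exact: leq_trans (max_pdiv_gt0 n) nP.
  rewrite (_ : (fun w => _) = fun=> 0); first exact: smooth_series0.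
  apply/funext => w; rewrite /a /kernel_coef /smooth_part (negbTE nS) mulr0.
  by case: ifP; rewrite mul0r.
have [g gM hg] := hM f f1.
pose u : A2 mu := K f + g.
(* Both series represent [F] at the integers [2, 3, ...], so [u] has no
   coefficient at a non-smooth integer and converges wherever [b] does. *)
have bu n : (0 < n)%N -> b n = u n.
  apply: A2_coef_unique.
    have h2 : half_plane 0 (2 : R[i]).
      by rewrite /half_plane/=; have := Re_int_ge2 (R := R) 0; rewrite addr0; lra.
    exact: (bF _ h2).1.
  move=> k; have hk := half_plane_int_ge2 (R := R) k.
  have hk0 : half_plane 0 (2 + k%:R : R[i]).
    by move: hk; rewrite /half_plane/=; apply: lt_trans; rewrite invr_gt0.
  rewrite (_ : dirichlet_series u _ = F (2 + k%:R)); first exact: (bF _ hk0).2.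
  have hA (h : A2 mu) := A2_abs_conv h (Re_int_ge2 (R := R) k).
  rewrite -fF -(subrK (dirichlet_series (K f) (2 + k%:R)) (dirichlet_series f _)).
  rewrite (hg _ hk) [_ + dirichlet_series (K f) _]addrC -(dirichlet_seriesD (hA (K f)) (hA g)).
  by [].
have Fs : F s = dirichlet_series (smooth_part P (K f)) s + dirichlet_series (smooth_part P g) s.
  rewrite -smooth_part_evalD// -(seq_lim (bF s s0).2) /dirichlet_series; congr (limn _).
  apply/funext => m; rewrite /dirichlet_sum big_nat [RHS]big_nat.
  apply: eq_bigr => n /andP[n0 _]; congr (_ * _); rewrite /smooth_part n0/=.
  by case: leqP => nP; [exact: bu | exact: b0].
have Fr : F s = r%:C.
  rewrite (_ : r = r^-1 * S); last by rewrite -rS expr2 mulKf// gt_eqF.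
  rewrite /F /S /kernel_sum mulr_sumr rmorph_sum/= [RHS]big_mkcond/= big_nat [RHS]big_nat.
  apply: eq_bigr => n /andP[n0 nN]; rewrite /a nN /kernel_coef /smooth_part n0/=.
  case: ifP => _; last by rewrite mulr0 mul0r.
  have e2 := natpow_conj_sub z n0; rewrite natpowD in e2.
  by rewrite !rmorphM/= fmorphV fmorphV -e2 -/z -!mulrA [_^-1 * natpow _ _]mulrC.
rewrite -rS ler_pXn2r// ?nnegrE//; last exact: ltW.
rewrite -[r]ger0_norm ?(ltW r0)// -normc_real -Fr Fs.
apply: le_trans (normcD _ _) _; rewrite mulrDl addrC lerD ?hK//.
apply: (le_trans (smooth_part_eval_le P g s0)).
by rewrite ler_wpM2r// kernel_norm_ge0.
Qed.

End essential_norm.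

(** The supremum over a strip grows with its width, so the limit exists. *)
Lemma limsup_Re0_le (R : realType) (F : R[i] -> \bar R) (x : \bar R) :
  (\forall t \near 0^'+, forall s, complex.Re s = t -> (F s <= x)%E) ->
  (limsup_Re0 F <= x)%E.
Proof.
move=> Fx; apply: lime_le.
  apply: nondecreasing_at_right_is_cvge; near=> a => t u _ _ tu.
  apply: le_ereal_sup => _ [s /andP[s0 st] <-]; exists s => //=.
  by rewrite s0 (lt_le_trans st).
have [d /= d0 hd] := Fx.
near=> t; apply: ge_ereal_sup => _ [s /= /andP[s0 st] <-].
apply: (hd (complex.Re s)) => //=.
have td : t <= d by near: t; exact: nbhs_right_le.
by rewrite sub0r normrN gtr0_norm// (lt_le_trans st).
Unshelve. all: by end_near. Qed.

Theorem theorem4 (R : realType) (mu : weight_measure R) (c0 l : nat)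
    (c : nat -> R[i]) (Phi : R[i] -> R[i])
    (hPhi : is_symbol c0 c Phi)
    (hl : (1 <= l)%N)
    (hc : forall n : nat, (1 <= n)%N -> (l < max_pdiv n)%N -> c n = 0) :
  (limsup_Re0 (fun s : R[i] =>
     A2_fun_norm mu (partial_kernel mu l (Phi s)) /
     A2_fun_norm mu (partial_kernel mu l s))
   <= A2_ess_norm mu (composition_op mu Phi))%E.
Proof.
pose P := nth_prime l.
have P2 : (2 <= P)%N := nth_prime_ge2 hl.
have cP m : (0 < m)%N -> (P < max_pdiv m)%N -> c m = 0.
  by move=> m0 Pm; apply: hc => //; exact: leq_ltn_trans (nth_prime_ge l) Pm.
apply: le_ereal_inf_tmp => _ [K Kc <-].
set T := A2_op_norm _.
have T_ge (f : A2 mu) : `|f| <= 1 -> (A2_fun_norm mu (fun s =>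
    (composition_op mu Phi f s - dirichlet_series (K f) s)%R) <= T)%E.
  by move=> f1; apply: ereal_sup_ubound; exists f.
have T0 : (0 <= T)%E.
  apply: le_trans (T_ge 0 _); last by rewrite normr0.
  by apply: le_ereal_inf_tmp => _ [g _ <-]; rewrite A2_normE lee_fin A2_rnorm_ge0.
case: T T0 T_ge => [M| |//] T0 T_ge; last by rewrite leey.
apply/lee_addgt0Pr => e e0; apply: limsup_Re0_le.
have e2 : 0 < e / 2 by rewrite divr_gt0.
near=> x => s sx.
have x0 : 0 < x by near: x; exact: nbhs_right_gt.
have k1 : 1 <= kernel_norm mu P x by near: x; exact: kernel_norm_cvg_pinfty.
have s0 : half_plane 0 s by rewrite /half_plane/= sx.
rewrite !A2_fun_norm_partial_kernel//; last exact: (symbol_Re_gt0 hPhi s0).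
have k0 : 0 < kernel_norm mu P (complex.Re s) by rewrite sx; exact: lt_le_trans k1.
rewrite inver gt_eqF// -EFinM lee_fin ler_pdivrMr//.
rewrite (_ : M + e = (M + e / 2) + e / 2); last by lra.
apply: (kernel_norm_symbol_le hPhi cP (K := K)) => //.
  move=> f f1; have f1' : `|f| <= 1 by rewrite A2_normE lecR.
  have : (A2_fun_norm mu (fun s =>
        (composition_op mu Phi f s - dirichlet_series (K f) s)%R)
      < (M + e / 2)%:E)%E.
    by apply: le_lt_trans (T_ge f f1') _; rewrite lte_fin ltrDl.
  move=> /ereal_inf_lt[_ [g /= hg <-]]; rewrite lte_fin => gM.
  by exists g => //; exact: ltW.
move=> f f1; rewrite sx; move: f f1 s sx {s0 k0}.
by near: x; exact: compact_smooth_part_eval_small.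
Unshelve. all: by end_near. Qed.
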